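(* Let $h\in\mathcal{S}$. Then the following are equivalent. (1) There exists an eventually periodic sequence $\{\gamma_i\}_{i=0}^\infty$ of points of $\mathcal{S}(\mathbb{Z})$ that is a continued fraction expansion for $h$. (2) There exists a matrix $M\in U(2,1;\mathbb{Z}[\mathrm{i}])$ that is not a root of unity and satisfies $$\vec{h}^{\dagger} J M \vec{h}=0.$$
   Context: The Heisenberg group in the planar Siegel model is $\mathcal{S}=\{(u,v)\in\mathbb{C}^2: |u|^2-2\operatorname{Re}(v)=0\}$ with group law $(u_1,v_1)*(u_2,v_2)=(u_1+u_2,\,v_1+\overline{u_1}u_2+v_2)$ and inverse $(u,v)^{-1}=(-u,\overline{v})$. The integer points are $\mathcal{S}(\mathbb{Z})=\mathcal{S}\cap\mathbb{Z}[\mathrm{i}]^2$. The Koranyi inversion is $\iota(u,v)=(-u/v,1/v)$. Identifying $(u,v)$ with the projective point $(1:u:v)$, $\mathcal{S}$ embeds in the projective Siegel model $\{(z_1:z_2:z_3): |z_2|^2-2\operatorname{Re}(\overline{z_1}z_3)=0\}$, which has one extra point, the point at infinity $\infty=(0:0:1)$; the maps extend to this model, with $\iota(0,0)=\infty$, $\iota(\infty)=(0,0)$, $\gamma*\infty=\infty$. For a sequence $\{\gamma_i\}_{i=0}^\infty$ of points of $\mathcal{S}(\mathbb{Z})$ (the point $(0,0)$ is allowed as a term), put $\mathbb{K}\{\gamma_i\}_{i=0}^n=\gamma_0\iota\gamma_1\iota\cdots\iota\gamma_n$, meaning $\gamma_0*(\iota(\gamma_1*(\iota(\gamma_2*\cdots\iota(\gamma_n)))))$.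 The sequence is a continued fraction expansion for $h\in\mathcal{S}$ if $h=\lim_{n\to\infty}\mathbb{K}\{\gamma_i\}_{i=0}^n$, with convergence in the Euclidean sense as points of $\mathbb{C}^2$. (The sequence is an arbitrary one; it need not come from any particular continued fraction algorithm.) $J=\begin{pmatrix}0&0&-1\\0&1&0\\-1&0&0\end{pmatrix}$, $\dagger$ denotes conjugate transpose, and $U(2,1;\mathbb{Z}[\mathrm{i}])=\{M\in \mathrm{GL}_3(\mathbb{Z}[\mathrm{i}]): M^\dagger JM=J\}$. A matrix $M\in U(2,1;\mathbb{Z}[\mathrm{i}])$ is ''not a root of unity'' if $M^n\neq I$ for every positive integer $n$. For $h=(u,v)\in\mathcal{S}$, $\vec{h}$ is the column vector $(1,u,v)^T$. *)

(* Defs.v *)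
From HB Require Import structures.
From mathcomp Require Import all_boot all_order all_algebra.
From mathcomp Require Import all_classical all_reals.
From mathcomp Require Import topology normedtype.
From mathcomp Require Import complex.

Set Implicit Arguments.
Unset Strict Implicit.
Unset Printing Implicit Defensive.

Import Order.TTheory GRing.Theory Num.Theory.
Import numFieldNormedType.Exports.

Local Open Scope classical_set_scope.
Local Open Scope sesquilinear_scope.
Local Open Scope ring_scope.

Section Heisenberg.
Variable R : realType.
Implicit Types (z : R[i]) (p q h : R[i] * R[i]) (P : option (R[i] * R[i])).
Implicit Types (g : nat -> R[i] * R[i]) (M : 'M[R[i]]_3).

Definition gaussian_int : {pred R[i]} :=
  [pred z | (complex.Re z \is a Num.int) && (complex.Im z \is a Num.int)].

Definition siegel : {pred R[i] * R[i]} :=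
  [pred p | `|p.1| ^+ 2 - 2 * 'Re p.2 == 0].

Definition siegel_int : {pred R[i] * R[i]} :=
  [pred p | [&& p \in siegel, p.1 \in gaussian_int & p.2 \in gaussian_int]].

Definition heis_mul p q : R[i] * R[i] :=
  (p.1 + q.1, p.2 + p.1^* * q.1 + q.2).

(* The projective Siegel model is encoded by [option (R[i] * R[i])]: [Some p]
   is the point (1 : p.1 : p.2) and [None] is the point at infinity
   (0 : 0 : 1), the only point of the model whose first coordinate is 0. *)

Definition heis_act p P : option (R[i] * R[i]) := omap (heis_mul p) P.

(* On the Siegel model v = 0 forces u = 0, so the test [p.2 == 0] singles out
   the origin. *)
Definition koranyi P : option (R[i] * R[i]) :=
  if P is Some p then
    if p.2 == 0 then None else Some (- p.1 / p.2, 1 / p.2)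
  else Some (0, 0).

Fixpoint cfrac g n : option (R[i] * R[i]) :=
  if n is n'.+1 then heis_act (g 0%N) (koranyi (cfrac (fun i => g i.+1) n'))
  else Some (g 0%N).

(* Finitely many convergents may be the point at infinity. The regular module
   [R[i]^o] is what carries the topology of the norm of [R[i]]. *)
Definition cfrac_expansion g h : Prop :=
  exists x : nat -> R[i]^o * R[i]^o,
    (\forall n \near \oo, cfrac g n = Some (x n)) /\
    x @ \oo --> (h : R[i]^o * R[i]^o).

Definition eventually_periodic g : Prop :=
  exists N T : nat, (0 < T)%N /\ forall n, (N <= n)%N -> g (n + T)%N = g n.

Definition siegel_form : 'M[R[i]]_3 :=
  \matrix_(i < 3, j < 3)
    (nth [::] [:: [::  0; 0; -1];
                  [::  0; 1;  0];
                  [:: -1; 0;  0]] i)`_j.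

Definition siegel_vec h : 'cV[R[i]]_3 := \col_(i < 3) [:: 1; h.1; h.2]`_i.

Definition gl3_gaussian M : Prop :=
  [/\ M \is a mxOver gaussian_int, M \in unitmx
    & invmx M \is a mxOver gaussian_int].

Definition u21_gaussian M : Prop :=
  gl3_gaussian M /\ M ^t* *m siegel_form *m M = siegel_form.

Definition not_root_of_unity M : Prop := forall n, (0 < n)%N -> M ^+ n <> 1.

End Heisenberg.

Arguments gaussian_int {R}.
Arguments siegel {R}.
Arguments siegel_int {R}.

(* Main.v *)
(* A condition [h^dagger J M h = 0] on a null vector h says that M fixes the
   null line of h, since distinct null lines are never orthogonal.

   From (1) to (2): the convergents are projective points [P_n infty] with P_n
   a product of Gaussian unitary matrices, and periodicity gives
   [P_(n+T) = M P_n] for a fixed M; in the limit M fixes h. If M had finite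
   order the convergents would be eventually constant, but two consecutive
   ones are always distinct.

   From (2) to (1): a Euclidean algorithm on the cusp [M infty] writes M as a
   product of the letters of a continued fraction times a diagonal matrix of
   units, which normalizes the letters and has order dividing 4; so the powers
   [M ^ (4 m)] are themselves words of a continued fraction. Conjugating h to
   the origin makes M triangular with diagonal (a, e, 1 / conj a), [|e| = 1].
   After replacing M by its inverse, [|a| >= 1]. If [|a| = 1], the traces
   [2 a^k + e^k] are bounded Gaussian integers, so a and e are roots of unity
   and some [M ^ (4 m)] is unipotent. In both cases the periodic repetition of
   the word converges to h, because in the coordinates sending h to infinity
   the word acts by affine maps whose orbits escape, unless they start at
   another fixed point; the convergents avoid that point, as its eigenvalue
   would have to be a Gaussian unit. *)
Require Import Defs.
From HB Require Import structures.
From mathcomp Require Import all_boot all_order all_algebra.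
From mathcomp Require Import all_classical all_reals.
From mathcomp Require Import topology normedtype.
From mathcomp Require Import complex ring lra zify.

Set Implicit Arguments.
Unset Strict Implicit.
Unset Printing Implicit Defensive.

Import Order.TTheory GRing.Theory Num.Theory.
Import numFieldNormedType.Exports.

Local Open Scope sesquilinear_scope.
Local Open Scope ring_scope.

(** * Gaussian integers and 3 x 3 matrices *)

Section GaussianIntegers.
Variable R : realType.
Implicit Types z : R[i].

Lemma gaussian_int_subring_closed : subring_closed (@gaussian_int R).
Proof.
split=> [|[a b] [c d]|[a b] [c d]]; rewrite !inE /=.
- by rewrite int_num1 int_num0.
- by move=> /andP[? ?] /andP[? ?]; rewrite !rpredB.
- by move=> /andP[? ?] /andP[? ?]; rewrite rpredB ?rpredD ?rpredM.
Qed.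

HB.instance Definition _ :=
  GRing.isSubringClosed.Build R[i] (@gaussian_int R) gaussian_int_subring_closed.

Lemma gaussian_int_conj z : z \in gaussian_int -> z^* \in gaussian_int.
Proof. by case: z => a b; rewrite !inE /= rpredN. Qed.

(** Integrality of the squared norm drives both the Euclidean descent and the recognition of
    units. *)
Lemma gaussian_int_normP z :
  z \in gaussian_int -> exists n : nat, `|z| ^+ 2 = n%:R.
Proof.
move=> /andP[/= za zb].
have /natrP[n En] : complex.Re z ^+ 2 + complex.Im z ^+ 2 \is a Num.nat.
  by rewrite rpredD // natr_exp_even.
by exists n; rewrite -add_Re2_Im2 En rmorph_nat.
Qed.

End GaussianIntegers.

Section Matrix3.
Variable C : numClosedFieldType.

(** With named entries, a matrix identity splits into nine scalar ones. *)
Definition mx3 (a b c d e f g h i : C) : 'M[C]_3 :=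
  \matrix_(j < 3, k < 3)
    (nth [::] [:: [:: a; b; c]; [:: d; e; f]; [:: g; h; i]] j)`_k.

Definition cv3 (a b c : C) : 'cV[C]_3 := \col_(i < 3) [:: a; b; c]`_i.

Lemma mx3P (M : 'M[C]_3) :
  exists a b c d e f g h i, M = mx3 a b c d e f g h i.
Proof.
exists (M 0 0), (M 0 1), (M 0 2), (M 1 0), (M 1 1), (M 1 2), (M 2 0), (M 2 1), (M 2 2).
by apply/matrixP => -[[|[|[|]]] // hi] [[|[|[|]]] // hj]; rewrite !mxE /=;
   congr (M _ _); apply: val_inj.
Qed.

Lemma cv3P (x : 'cV[C]_3) : exists a b c, x = cv3 a b c.
Proof.
exists (x 0 0), (x 1 0), (x 2 0).
by apply/matrixP => -[[|[|[|]]] // hi] [[|//] hj]; rewrite !mxE /=;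
   congr (x _ _); apply: val_inj.
Qed.

Lemma mx3_inj a b c d e f g h i a' b' c' d' e' f' g' h' i' :
  mx3 a b c d e f g h i = mx3 a' b' c' d' e' f' g' h' i' ->
  [/\ [/\ a = a', b = b' & c = c'], [/\ d = d', e = e' & f = f']
    & [/\ g = g', h = h' & i = i']].
Proof.
move=> /matrixP E; move: (E 0 0) (E 0 1) (E 0 2) (E 1 0) (E 1 1) (E 1 2)
  (E 2 0) (E 2 1) (E 2 2).
by rewrite !mxE.
Qed.

Lemma cv3_inj a b c a' b' c' :
  cv3 a b c = cv3 a' b' c' -> [/\ a = a', b = b' & c = c'].
Proof.
by move=> /matrixP E; move: (E 0 0) (E 1 0) (E 2 0); rewrite !mxE.
Qed.

Lemma mul_mx3 a b c d e f g h i a' b' c' d' e' f' g' h' i' :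
  mx3 a b c d e f g h i *m mx3 a' b' c' d' e' f' g' h' i' =
  mx3 (a * a' + b * d' + c * g') (a * b' + b * e' + c * h') (a * c' + b * f' + c * i')
      (d * a' + e * d' + f * g') (d * b' + e * e' + f * h') (d * c' + e * f' + f * i')
      (g * a' + h * d' + i * g') (g * b' + h * e' + i * h') (g * c' + h * f' + i * i').
Proof.
by apply/matrixP => -[[|[|[|]]] // hi] [[|[|[|]]] // hj];
   rewrite !mxE !big_ord_recl big_ord0 !mxE /= addr0 addrA.
Qed.

Lemma mul_mx3_cv3 a b c d e f g h i x y z :
  mx3 a b c d e f g h i *m cv3 x y z =
  cv3 (a * x + b * y + c * z) (d * x + e * y + f * z) (g * x + h * y + i * z).
Proof.
by apply/matrixP => -[[|[|[|]]] // hi] [[|//] hj];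
   rewrite !mxE !big_ord_recl big_ord0 !mxE /= addr0 addrA.
Qed.

Lemma scale_cv3 k x y z : k *: cv3 x y z = cv3 (k * x) (k * y) (k * z).
Proof.
by apply/matrixP => -[[|[|[|]]] // hi] [[|//] hj]; rewrite !mxE.
Qed.

Lemma mx3_adj a b c d e f g h i :
  (mx3 a b c d e f g h i)^t* = mx3 a^* d^* g^* b^* e^* h^* c^* f^* i^*.
Proof.
by apply/matrixP => -[[|[|[|]]] // hi] [[|[|[|]]] // hj]; rewrite !mxE.
Qed.

Lemma mx3_1 : 1%:M = mx3 1 0 0 0 1 0 0 0 1.
Proof.
by apply/matrixP => -[[|[|[|]]] // hi] [[|[|[|]]] // hj]; rewrite !mxE.
Qed.

Lemma mx3_trace a b c d e f g h i : \tr (mx3 a b c d e f g h i) = a + e + i.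
Proof. by rewrite /mxtrace !big_ord_recl big_ord0 !mxE /= addr0 addrA. Qed.

Lemma mx3_over (S : {pred C}) a b c d e f g h i :
  (mx3 a b c d e f g h i \is a mxOver S) =
  [&& [&& a \in S, b \in S & c \in S], [&& d \in S, e \in S & f \in S],
      g \in S, h \in S & i \in S].
Proof.
apply/mxOverP/idP => [H|].
  by move: (H 0 0) (H 0 1) (H 0 2) (H 1 0) (H 1 1) (H 1 2)
    (H 2 0) (H 2 1) (H 2 2); rewrite !mxE /= => -> -> -> -> -> -> -> -> ->.
case/and5P => /and3P[? ? ?] /and3P[? ? ?] ? ? ?.
by move=> -[[|[|[|]]] // hi] [[|[|[|]]] // hj]; rewrite !mxE.
Qed.
End Matrix3.

(** * Isometries of the Siegel form *)

Section SiegelModel.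
Variable R : realType.
Implicit Types (p q : R[i] * R[i]) (x y : 'cV[R[i]]_3) (M N : 'M[R[i]]_3).
Local Notation J := (siegel_form R).

Definition siegel_unitary M : Prop := M^t* *m J *m M = J.

Definition null x : Prop := x^t* *m J *m x = 0.

(** Left translation by [p] in the coordinates [(1 : u : v)]. *)
Definition heis_mx p := mx3 1 0 0 p.1 1 0 p.2 p.1^* 1.

Definition heis_inv p : R[i] * R[i] := (- p.1, p.2^*).

(** Sends [(1 : u : v)] to [(v : - u : 1)]: the Koranyi inversion, with the origin and infinity no
    longer exceptional. *)
Definition koranyi_mx : 'M[R[i]]_3 := mx3 0 0 1 0 (-1) 0 1 0 0.

Definition affine_point x : option (R[i] * R[i]) :=
  if x 0 0 == 0 then None else Some (x 1 0 / x 0 0, x 2 0 / x 0 0).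

Lemma siegelP p : reflect (p.1^* * p.1 = p.2 + p.2^*) (p \in siegel).
Proof.
rewrite inE -normCKC subr_eq0 ReE mulrC divfK ?pnatr_eq0 //.
exact: eqP.
Qed.

Lemma siegel_formE : J = mx3 0 0 (-1) 0 1 0 (-1) 0 0.
Proof. by []. Qed.

Lemma siegel_vecE p : siegel_vec p = cv3 1 p.1 p.2.
Proof. by []. Qed.

Lemma siegel_form_sq : J *m J = 1%:M.
Proof. by rewrite siegel_formE mul_mx3 mx3_1; congr mx3; ring. Qed.

Lemma koranyi_mx_sq : koranyi_mx *m koranyi_mx = 1%:M.
Proof. by rewrite mul_mx3 mx3_1; congr mx3; ring. Qed.

Lemma adjM (m n k : nat) (A : 'M[R[i]]_(m, n)) (B : 'M[R[i]]_(n, k)) :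
  (A *m B)^t* = B^t* *m A^t*.
Proof. by rewrite trmx_mul map_mxM. Qed.

Lemma siegel_unitary1 : siegel_unitary 1%:M.
Proof. by rewrite /siegel_unitary trmx1 map_mx1 mul1mx mulmx1. Qed.

Lemma siegel_unitaryM M N : siegel_unitary M -> siegel_unitary N -> siegel_unitary (M *m N).
Proof.
move=> iM iN; rewrite /siegel_unitary adjM -[RHS]iN -[in RHS]iM.
by rewrite !mulmxA.
Qed.

(** As [J] squares to 1, multiplying the unitarity relation by [J] exhibits the inverse, in a form
    that keeps Gaussian entries Gaussian. *)
Lemma siegel_unitary_left_inv M : siegel_unitary M -> (J *m M^t* *m J) *m M = 1%:M.
Proof. by move=> iM; rewrite -!mulmxA (mulmxA _ J) iM siegel_form_sq. Qed.

Lemma siegel_unitary_unit M : siegel_unitary M -> M \in unitmx.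
Proof. by move=> /siegel_unitary_left_inv /mulmx1_unit[]. Qed.

Lemma siegel_unitary_invE M : siegel_unitary M -> invmx M = J *m M^t* *m J.
Proof.
by move=> iM; rewrite -[RHS](mulmxK (siegel_unitary_unit iM)) siegel_unitary_left_inv ?mul1mx.
Qed.

Lemma siegel_unitaryV M : siegel_unitary M -> siegel_unitary (invmx M).
Proof.
move=> iM; have uM := siegel_unitary_unit iM.
rewrite /siegel_unitary -[in LHS]iM !mulmxA -adjM mulmxV // trmx1 map_mx1 mul1mx.
by rewrite -mulmxA mulmxV // mulmx1.
Qed.

Lemma siegel_unitaryX M n : siegel_unitary M -> siegel_unitary (M ^+ n).
Proof.
move=> iM; elim: n => [|n IH]; first exact: siegel_unitary1.
by rewrite exprS; apply: siegel_unitaryM.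
Qed.

Lemma siegel_unitary_null M x : siegel_unitary M -> null x -> null (M *m x).
Proof.
move=> iM nx; rewrite /null.
have -> : (M *m x)^t* *m J *m (M *m x) = x^t* *m (M^t* *m J *m M) *m x.
  by rewrite adjM !mulmxA.
by rewrite iM.
Qed.

Lemma siegel_unitary_heis_mx p : p \in siegel -> siegel_unitary (heis_mx p).
Proof.
move=> /siegelP sp; rewrite /siegel_unitary siegel_formE /heis_mx mx3_adj !mul_mx3.
have sp' : p.2^* = p.1^* * p.1 - p.2 by rewrite sp; ring.
rewrite !rmorph0 !rmorph1 ?conjCK sp'.
by congr mx3; ring.
Qed.

Lemma siegel_unitary_koranyi_mx : siegel_unitary koranyi_mx.
Proof.
rewrite /siegel_unitary siegel_formE mx3_adj !mul_mx3 !rmorphN !rmorph0 !rmorph1.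
by congr mx3; ring.
Qed.

Lemma siegel_inv p : p \in siegel -> heis_inv p \in siegel.
Proof.
move=> /siegelP sp; apply/siegelP.
by rewrite /= conjCK rmorphN mulrNN sp addrC.
Qed.

Lemma heis_mxVl p : p \in siegel -> heis_mx (heis_inv p) *m heis_mx p = 1%:M.
Proof.
move=> /siegelP sp; rewrite mul_mx3 mx3_1 /= rmorphN.
have -> : p.2^* = p.1^* * p.1 - p.2 by rewrite sp; ring.
by congr mx3; ring.
Qed.

Lemma heis_mxVr p : p \in siegel -> heis_mx p *m heis_mx (heis_inv p) = 1%:M.
Proof. by move=> sp; apply: mulmx1C; exact: heis_mxVl. Qed.

Lemma siegel_unitary_heis_conj p M : p \in siegel -> siegel_unitary M ->
  siegel_unitary (heis_mx (heis_inv p) *m M *m heis_mx p).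
Proof.
move=> sp uM; apply: siegel_unitaryM (siegel_unitary_heis_mx sp).
by apply: siegel_unitaryM uM; apply/siegel_unitary_heis_mx/siegel_inv.
Qed.

Lemma heis_mx0 : heis_mx 0 = 1%:M.
Proof. by rewrite mx3_1 /heis_mx /= rmorph0. Qed.

Lemma nullP a b c : null (cv3 a b c) <-> b^* * b = a^* * c + c^* * a.
Proof.
rewrite /null.
have -> : (cv3 a b c)^t* *m J *m cv3 a b c
   = (b^* * b - a^* * c - c^* * a)%:M.
  apply/matrixP => -[[|//] hi] [[|//] hj].
  rewrite !mxE !big_ord_recl big_ord0 !mxE /= !big_ord_recl !big_ord0 !mxE /=.
  ring.
split=> [/matrixP/(_ 0 0)|E]; last by rewrite E; apply/matrixP => i j;
  rewrite !mxE; case: eqP => // _; rewrite ?mulr1n; ring.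
by rewrite !mxE mulr1n => E; apply/eqP; rewrite -subr_eq0 opprD addrA E.
Qed.

Lemma siegel_null p : p \in siegel <-> null (siegel_vec p).
Proof.
rewrite siegel_vecE nullP rmorph1 mul1r mulr1.
by split=> /siegelP.
Qed.

Lemma null_infty x : null x -> x 0 0 = 0 -> x 1 0 = 0.
Proof.
have [a [b [c ->]]] := cv3P x; rewrite nullP !mxE /= => E a0.
move: E; rewrite a0 rmorph0 mulr0 mul0r addr0 => /eqP.
by rewrite mulf_eq0 conjC_eq0 orbb => /eqP.
Qed.

(* The hypothesis [g = 0] says that the null line of the first basis vector is
   fixed, because the image of that vector is null. *)
Lemma siegel_unitary_triangular a b c d e f g h i :
  siegel_unitary (mx3 a b c d e f g h i) -> g = 0 ->
  [/\ d = 0, h = 0, a^* * i = 1, e^* * e = 1 & e^* * f = b^* * i].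
Proof.
rewrite /siegel_unitary siegel_formE mx3_adj !mul_mx3 => /mx3_inj[].
move=> [E11 E12 E13] [E21 E22 E23] [E31 E32 E33] g0; subst g.
have d0 : d = 0.
  by apply/eqP; rewrite -normr_eq0 -sqrf_eq0 normCKC; apply/eqP; move: E11;
     rewrite !rmorph0 => E; rewrite -[RHS]E; ring.
subst d; move: E11 E12 E13 E21 E22 E23 E31 E32 E33; rewrite !rmorph0.
move=> _ E12 E13 _ E22 E23 _ _ _.
have ai : a^* * i = 1 by rewrite -[RHS]opprK -E13; ring.
have a0 : a^* != 0 by apply/eqP => a0; move: ai; rewrite a0 mul0r => /esym/eqP;
  rewrite oner_eq0.
have h0 : h = 0 by apply: (mulfI a0); 
  apply/eqP; rewrite mulr0 -oppr_eq0; apply/eqP; rewrite -[RHS]E12; ring.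
subst h; rewrite !rmorph0 in E22 E23; split=> //.
  by rewrite -[RHS]E22; ring.
by apply/eqP; rewrite -subr_eq0; apply/eqP; rewrite -[RHS]E23; ring.
Qed.
End SiegelModel.

(** * The Euclidean algorithm *)

Section EuclideanAlgorithm.
Variable R : realType.
Implicit Types (p q : R[i] * R[i]) (M : 'M[R[i]]_3) (s : seq (R[i] * R[i])).

Lemma round_int (r : R) : exists m : int, - (2^-1) <= r - m%:~R <= 2^-1.
Proof.
exists (Num.floor (r + 2^-1)).
by have := floor_itv (r + 2^-1); rewrite intrD => /andP[]; lra.
Qed.

(* The first coordinates of the points of S(Z) form the lattice (1 + i)Z[i],
   whose covering radius is 1; so [Re v <= 1/2] and [|Im v| <= 1/2] can be
   achieved for the second coordinate of the translated point. *)
Lemma siegel_int_approx p : p \in siegel ->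
  exists2 q, q \in siegel_int & `|(heis_mul (heis_inv q) p).2| < 1.
Proof.
case: p => [[x y] [w t]] /siegelP sp.
have {}sp : w = (x ^+ 2 + y ^+ 2) / 2.
  by move: sp => /eqP; rewrite eq_complex /= => /andP[/eqP sp _]; lra.
have [k kP] := round_int ((x + y) / 2).
have [l lP] := round_int ((x - y) / 2).
(* The point [m + n i] is [1 + i] times [k - l i]. Its squared norm [2 * (k ^+ 2 + l ^+ 2)] dictates
   the real part of the second coordinate of the witness. *)
set m : R := k%:~R + l%:~R; set n : R := k%:~R - l%:~R.
(* The group law twists the imaginary part by [m * y - n * x], which is removed before rounding. *)
have [j jP] := round_int (t - (m * y - n * x)).
exists (Complex m n, Complex (k%:~R ^+ 2 + l%:~R ^+ 2) j%:~R).
  rewrite inE; apply/and3P; split.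
  - apply/siegelP; apply/eqP; rewrite eq_complex /= /m /n.
    by apply/andP; split; apply/eqP; ring.
  - by rewrite inE /= /m /n rpredB ?rpredD ?intr_int.
  - by rewrite inE /= rpredD ?rpredX ?intr_int.
rewrite -(@expr_lt1 _ 2) // -add_Re2_Im2 (_ : 1 = (1 : R)%:C%C) // ltcR /=.
set A : R := (x + y) / 2 - k%:~R in kP; set B : R := (x - y) / 2 - l%:~R in lP.
set D : R := _ - _ in jP.
have sq (z : R) : - 2^-1 <= z <= 2^-1 -> z ^+ 2 <= 4^-1.
  by move=> /andP[z1 z2]; nra.
have {}kP := sq _ kP.
have {}lP := sq _ lP.
have {}jP := sq _ jP.
set u := (X in X ^+ 2 + _); have -> : u = A ^+ 2 + B ^+ 2.
  by rewrite /u sp /A /B /m /n; field.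
set v := (X in _ + X ^+ 2); have -> : v = D by rewrite /v /D /m /n; ring.
have : 0 <= A ^+ 2 + B ^+ 2 by rewrite addr_ge0 ?sqr_ge0.
by move: (A ^+ 2) (B ^+ 2) kP lP => A2 B2; nra.
Qed.

(** Integer coordinates whose squares sum to 1 lie on an axis, where the square of [z] is 1 or
    [-1]. *)
Lemma gaussian_int_unit_exp4 (z : R[i]) :
  z \in gaussian_int -> `|z| = 1 -> z ^+ 4 = 1.
Proof.
case: z => a b /andP[/= ia ib] z1.
have E : a ^+ 2 + b ^+ 2 = 1.
  by apply: complexI; rewrite (add_Re2_Im2 (Complex a b)) z1 expr1n.
have [a0|a0] := eqVneq a 0.
  have b2 : b ^+ 2 = 1 by rewrite -E a0; ring.
  rewrite -[4%N]/(2 * 2)%N exprM a0; suff -> : Complex 0 b ^+ 2 = -1.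
    by rewrite sqrrN expr1n.
  apply/eqP; rewrite expr2 eq_complex /=; apply/andP.
  by split; apply/eqP; rewrite -?b2; ring.
have := sqr_intr_ge1 ia a0; have := sqr_ge0 b => b0 a1.
have b2 : b ^+ 2 = 0 by lra.
have a2 : a ^+ 2 = 1 by lra.
move/eqP: b2; rewrite sqrf_eq0 => /eqP->.
rewrite -[4%N]/(2 * 2)%N exprM; suff -> : Complex a 0 ^+ 2 = 1.
  by rewrite expr1n.
apply/eqP; rewrite expr2 eq_complex /=; apply/andP.
by split; apply/eqP; rewrite -?a2; ring.
Qed.

(** The squared norms are natural numbers with product 1. *)
Lemma gaussian_int_conj_unit (z w : R[i]) :
  z \in gaussian_int -> w \in gaussian_int -> z^* * w = 1 ->
  `|z| = 1 /\ w = z.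
Proof.
move=> gz gw zw; have [m Em] := gaussian_int_normP gz.
have [n En] := gaussian_int_normP gw.
have : `|z^* * w| ^+ 2 = 1 by rewrite zw normr1 expr1n.
rewrite normrM norm_conjC exprMn Em En -natrM => /eqP.
rewrite pnatr_eq1 muln_eq1 => /andP[/eqP m1 _].
have z1 : `|z| = 1.
  by apply/eqP; rewrite -sqrp_eq1 // Em m1.
split=> //; apply: (@mulfI _ z^*); last by rewrite zw -normCKC z1 expr1n.
by rewrite conjC_eq0 -normr_eq0 z1 oner_eq0.
Qed.

Definition gaussian_unitary M : Prop :=
  M \is a mxOver gaussian_int /\ siegel_unitary M.

Lemma gaussian_unitaryM M N :
  gaussian_unitary M -> gaussian_unitary N -> gaussian_unitary (M *m N).
Proof.
by move=> [gM iM] [gN iN]; split; [exact: mxOverM | exact: siegel_unitaryM].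
Qed.

Lemma gaussian_unitary1 : gaussian_unitary 1%:M.
Proof.
by split; [rewrite mx3_1 mx3_over !rpred0 !rpred1 | exact: siegel_unitary1].
Qed.

Lemma gaussian_unitaryX M n : gaussian_unitary M -> gaussian_unitary (M ^+ n).
Proof.
move=> gM; elim: n => [|n IH]; first exact: gaussian_unitary1.
by rewrite exprS; apply: gaussian_unitaryM.
Qed.

Lemma gaussian_unitaryV M : gaussian_unitary M -> gaussian_unitary (invmx M).
Proof.
move=> [gM iM]; split; last exact: siegel_unitaryV.
have gJ : siegel_form R \is a mxOver gaussian_int.
  by rewrite siegel_formE mx3_over !rpredN !rpred0 !rpred1.
rewrite siegel_unitary_invE //; apply: mxOverM => //; apply: mxOverM => //.
by apply/mxOverP => i j; rewrite !mxE; apply/gaussian_int_conj/(mxOverP gM).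
Qed.

Lemma u21_gaussianP M : u21_gaussian M <-> gaussian_unitary M.
Proof.
split=> [[[? ? ?] ?] //|gM]; have [gM' _] := gaussian_unitaryV gM.
by case: gM => ? iM; split=> //; split=> //; exact: siegel_unitary_unit.
Qed.

Lemma siegel_intP p : reflect
  [/\ p \in siegel, p.1 \in gaussian_int & p.2 \in gaussian_int]
  (p \in siegel_int).
Proof. by rewrite inE; exact: and3P. Qed.

Lemma siegel_int0 : (0 : R[i] * R[i]) \in siegel_int.
Proof.
apply/siegel_intP; split; rewrite ?rpred0 //.
by apply/siegelP; rewrite /= !rmorph0 mulr0 addr0.
Qed.

Lemma gaussian_unitary_heis_mx p :
  p \in siegel_int -> gaussian_unitary (heis_mx p).
Proof.
move=> /siegel_intP[sp g1 g2]; split; last exact: siegel_unitary_heis_mx.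
by rewrite mx3_over !rpred0 !rpred1 g1 g2 gaussian_int_conj.
Qed.

Lemma gaussian_unitary_koranyi_mx : gaussian_unitary (koranyi_mx R).
Proof.
split; last exact: siegel_unitary_koranyi_mx.
by rewrite mx3_over !rpredN !rpred0 !rpred1.
Qed.

Lemma siegel_int_inv p : p \in siegel_int -> heis_inv p \in siegel_int.
Proof.
move=> /siegel_intP[sp g1 g2]; apply/siegel_intP; split.
- exact: siegel_inv.
- by rewrite rpredN.
- exact: gaussian_int_conj.
Qed.

Lemma heis_mx_vec p q : heis_mx p *m siegel_vec q = siegel_vec (heis_mul p q).
Proof.
by rewrite !siegel_vecE mul_mx3_cv3 /=; congr cv3; ring.
Qed.

(** Every letter, the last one included, is followed by an inversion, so that concatenation of words
    becomes the product of matrices. *)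
Definition cfrac_mx s : 'M[R[i]]_3 :=
  foldr (fun p M => heis_mx p *m (koranyi_mx R *m M)) 1%:M s.

Lemma cfrac_mx_cat s t : cfrac_mx (s ++ t) = cfrac_mx s *m cfrac_mx t.
Proof.
by elim: s => [|p s IH] /=; rewrite ?mul1mx // IH !mulmxA.
Qed.

Lemma gaussian_unitary_cfrac_mx s :
  {in s, forall p, p \in siegel_int} -> gaussian_unitary (cfrac_mx s).
Proof.
elim: s => [|p s IH] sP; first exact: gaussian_unitary1.
have ps : p \in siegel_int by apply: sP; rewrite mem_head.
apply: gaussian_unitaryM; first exact: gaussian_unitary_heis_mx.
apply: gaussian_unitaryM; first exact: gaussian_unitary_koranyi_mx.
by apply: IH => q qs; apply: sP; rewrite inE qs orbT.
Qed.

(** Unitarity makes one outer entry the conjugate inverse of the other, which for Gaussian units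
    means that they agree. *)
Definition unit_diag (a b : R[i]) : 'M[R[i]]_3 := mx3 a 0 0 0 b 0 0 0 a.

Lemma unit_diag1 : unit_diag 1 1 = 1%:M.
Proof. by rewrite mx3_1. Qed.

Lemma unit_diagM a b c d :
  unit_diag a b *m unit_diag c d = unit_diag (a * c) (b * d).
Proof. by rewrite mul_mx3; congr mx3; ring. Qed.

Definition gaussian_unit (a : R[i]) : Prop := a \in gaussian_int /\ `|a| = 1.

(** The vanishing entry says that [M] fixes infinity; what remains is a diagonal isometry followed
    by the translation to the image of the origin. *)
Lemma cfrac_mx_stab_infty M : gaussian_unitary M -> M 0 2 = 0 ->
  exists p a b, [/\ p \in siegel_int, gaussian_unit a, gaussian_unit b
    & M = heis_mx p *m unit_diag a b].
Proof.
have [a [b [c [d [e [f [g [h [i ->]]]]]]]]] := mx3P M => gM.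
rewrite mxE /= => c0; subst c.
(* Conjugation by the inversion exchanges infinity and the origin, which brings [M] to the
   triangular form already studied. *)
have [_] := gaussian_unitaryM gaussian_unitary_koranyi_mx
  (gaussian_unitaryM gM gaussian_unitary_koranyi_mx).
have -> : koranyi_mx R *m (mx3 a b 0 d e f g h i *m koranyi_mx R)
    = mx3 i (- h) g (- f) e (- d) 0 (- b) a.
  by rewrite !mul_mx3; congr mx3; ring.
move=> /siegel_unitary_triangular[] // /eqP f0 /eqP b0 ia ee.
rewrite mulrN rmorphN mulNr => /oppr_inj de.
move: f0 b0; rewrite !oppr_eq0 => /eqP f0 /eqP b0; subst f b.
have [+ iM] := gM.
rewrite mx3_over => /and5P[/and3P[ga gb _] /and3P[gd ge gf] gg gh gi].
have [i1 ai] := gaussian_int_conj_unit gi ga ia; subst i.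
have e1 : `|e| = 1 by apply/eqP; rewrite -sqrp_eq1 // normCKC ee.
(* The first column [(a, d, g)] is the image of the origin; dividing by the unit [a] is multiplying
   by its conjugate. *)
exists (d * a^*, g * a^*), a, e; split=> //; last first.
  rewrite mul_mx3 /= !rmorphM /= conjCK; congr mx3; rewrite ?mul1r ?mul0r ?mulr0 ?addr0 ?add0r //.
  - by rewrite -mulrA ia mulr1.
  - by rewrite -mulrA ia mulr1.
  - have {}de : e * d^* = h * a^*.
      by rewrite -[e]conjCK -[h]conjCK -!rmorphM de.
    transitivity (h * a^* * a); first by rewrite -mulrA ia mulr1.
    by rewrite -de; ring.
apply/siegel_intP; split=> /=; rewrite ?rpredM ?gaussian_int_conj //.
have : null (cv3 a d g).
  have -> : cv3 a d g = mx3 a 0 0 d e 0 g h a *m cv3 1 0 0.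
    by rewrite mul_mx3_cv3; congr cv3; ring.
  by apply: siegel_unitary_null => //; apply/nullP; rewrite rmorph0; ring.
move=> /nullP E; apply/siegelP; rewrite /= !rmorphM /= !conjCK.
transitivity (d^* * d * (a^* * a)); first ring.
by rewrite ia mulr1 E; ring.
Qed.

Lemma gaussian_unitary_last_col M : gaussian_unitary M ->
  null (M *m cv3 0 0 1) /\ M *m cv3 0 0 1 = cv3 (M 0 2) (M 1 2) (M 2 2).
Proof.
move=> [_ iM]; split.
  by apply: siegel_unitary_null => //; apply/nullP; rewrite rmorph0; ring.
have [a [b [c [d [e [f [g [h [i ->]]]]]]]]] := mx3P M.
by rewrite mul_mx3_cv3 !mxE /=; congr cv3; ring.
Qed.

Lemma null_affine (a b c : R[i]) : a != 0 -> null (cv3 a b c) -> (b / a, c / a) \in siegel.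
Proof.
move=> a0 /nullP E; apply/siegelP; rewrite /= !rmorphM !fmorphV.
have a0' : a^* != 0 by rewrite conjC_eq0.
by rewrite mulrACA E; field; rewrite a0 a0'.
Qed.

(* Euclidean algorithm: [|M 0 2|] is the height of the cusp [M infty], and it
   decreases when the nearest integer point is subtracted and the result
   inverted. *)
Lemma gaussian_unitary_cfrac M : gaussian_unitary M ->
  exists s a b, [/\ {in s, forall p, p \in siegel_int}, gaussian_unit a,
    gaussian_unit b & M = cfrac_mx s *m unit_diag a b].
Proof.
move=> gM; have /gaussian_int_normP[n En] := mxOverP gM.1 0 2.
elim/ltn_ind: n M gM En => n IH M gM En.
have [M0|M0] := eqVneq (M 0 2) 0.
  have [p [a [b [pS ua ub ->]]]] := cfrac_mx_stab_infty gM M0.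
  (* The extra letter [0] only serves to let the two inversions cancel. *)
  exists [:: p; 0], a, b; split=> //.
    by move=> q; rewrite !inE => /orP[] /eqP-> //; exact: siegel_int0.
  by rewrite /= heis_mx0 mulmx1 mul1mx koranyi_mx_sq mulmx1.
have [nM EM] := gaussian_unitary_last_col gM; rewrite EM in nM.
have pS := null_affine M0 nM.
have [q qS] := siegel_int_approx pS.
set p := (_, _) in pS *; set p' := heis_mul _ _ => p'1.
pose M1 := koranyi_mx R *m (heis_mx (heis_inv q) *m M).
have gM1 : gaussian_unitary M1.
  apply: gaussian_unitaryM; first exact: gaussian_unitary_koranyi_mx.
  by apply: gaussian_unitaryM => //; apply/gaussian_unitary_heis_mx/siegel_int_inv.
(* The inversion moves the last coordinate to the front, so the height is multiplied by [p'.2], of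
   norm below 1. *)
have EM1 : M1 0 2 = M 0 2 * p'.2.
  have [_] := gaussian_unitary_last_col gM1.
  rewrite /M1 -!mulmxA EM.
  have -> : cv3 (M 0 2) (M 1 2) (M 2 2) = M 0 2 *: siegel_vec p.
    by rewrite siegel_vecE scale_cv3 /=; congr cv3; field.
  rewrite -!scalemxAr heis_mx_vec siegel_vecE mul_mx3_cv3 scale_cv3.
  by move=> /cv3_inj[<- _ _]; ring.
have /gaussian_int_normP[m Em] := mxOverP gM1.1 0 2.
have mn : (m < n)%N.
  rewrite -(ltr_nat R[i]) -En -Em EM1 normrM exprMn gtr_pMr ?expr_lt1 //.
  by rewrite exprn_gt0 // normr_gt0.
have [s [a [b [sS ua ub E]]]] := IH m mn M1 gM1 Em.
exists (q :: s), a, b; split=> //.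
  by move=> r; rewrite inE => /orP[/eqP->//|/sS].
rewrite /= -!mulmxA -E /M1 (mulmxA (koranyi_mx R)) koranyi_mx_sq mul1mx.
by rewrite mulmxA heis_mxVr ?mul1mx //; case/siegel_intP: qS.
Qed.

(** The diagonal matrix commutes with the inversion because its outer entries agree, and passes a
    translation by rotating the first coordinate by the unit [a^* * b]. *)
Lemma unit_diag_cfrac_mx a b s : gaussian_unit a -> gaussian_unit b ->
  {in s, forall p, p \in siegel_int} ->
  exists2 t, {in t, forall p, p \in siegel_int} &
    unit_diag a b *m cfrac_mx s = cfrac_mx t *m unit_diag a b.
Proof.
move=> [ga a1] [gb b1].
have aa : a^* * a = 1 by rewrite -normCKC a1 expr1n.
have bb : b^* * b = 1 by rewrite -normCKC b1 expr1n.
elim: s => [|p s IH] sS; first by exists [::] => //; rewrite mulmx1 mul1mx.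
have [|t tS Et] := IH; first by move=> q qs; apply: sS; rewrite inE qs orbT.
have /siegel_intP[/siegelP sp g1 g2] : p \in siegel_int.
  by apply: sS; rewrite mem_head.
exists ((a^* * b * p.1, p.2) :: t).
  move=> q; rewrite inE => /orP[/eqP->|/tS//]; apply/siegel_intP; split=> //=.
    apply/siegelP; rewrite /= -sp !rmorphM /= !conjCK.
    transitivity ((a^* * a) * (b^* * b) * (p.1^* * p.1)); first ring.
    by rewrite aa bb !mul1r.
  by rewrite !rpredM // gaussian_int_conj.
rewrite /= -!mulmxA -Et !mulmxA; congr (_ *m _).
rewrite !mul_mx3 /= !rmorphM /= !conjCK; congr mx3; try ring.
  transitivity (a^* * a * (b * p.1)); first by rewrite aa; ring.
  ring.
transitivity (- (b^* * b * (a * p.1^*))); first by rewrite bb; ring.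
ring.
Qed.

(** Moving all diagonal factors to the right leaves a word times a power of the diagonal, which is
    trivial for exponents divisible by 4. *)
Lemma gaussian_unitaryX_cfrac M n : gaussian_unitary M ->
  exists2 s, {in s, forall p, p \in siegel_int} & M ^+ (4 * n) = cfrac_mx s.
Proof.
move=> /gaussian_unitary_cfrac[s [a [b [sS ua ub EM]]]].
have [t tS Et] : exists2 t, {in t, forall p, p \in siegel_int} &
    M ^+ (4 * n) = cfrac_mx t *m unit_diag (a ^+ (4 * n)) (b ^+ (4 * n)).
  move: (4 * n)%N => k; elim: k => [|k [t tS Et]].
    by exists [::] => //=; rewrite !expr0 unit_diag1 mul1mx.
  have [t' tS' Et'] := unit_diag_cfrac_mx ua ub tS.
  exists (s ++ t').
    by move=> q; rewrite mem_cat => /orP[/sS|/tS'].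
  rewrite exprS Et -[_ * _]/(_ *m _) {1}EM cfrac_mx_cat -!mulmxA.
  congr (_ *m _); rewrite !mulmxA Et' -!mulmxA unit_diagM.
  by rewrite !exprS.
exists t => //; rewrite Et !exprM.
rewrite (gaussian_int_unit_exp4 ua.1 ua.2) (gaussian_int_unit_exp4 ub.1 ub.2).
by rewrite !expr1n unit_diag1 mulmx1.
Qed.
End EuclideanAlgorithm.

(** * Power sums and affine recurrences *)

Section RootsOfUnity.
Variable R : realType.

Lemma pigeonhole (T : finType) (f : nat -> T) :
  exists k m, (0 < m)%N /\ f k = f (k + m)%N.
Proof.
pose g (i : 'I_(#|T|.+1)) := f i.
have /injectivePn[i [j ij gij]] : ~~ injectiveb g.
  by apply/injectiveP => /leq_card; rewrite card_ord ltnn.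
wlog lt_ij : i j ij gij / (i < j)%N.
  move=> W; case: (ltngtP i j) => [|ji|/val_inj ij']; first exact: W.
    by apply: (W j i) => //; rewrite eq_sym.
  by rewrite ij' eqxx in ij.
by exists i, (j - i)%N; rewrite subn_gt0 (subnKC (ltnW lt_ij)).
Qed.

(** Coordinates are integers between -3 and 3, shifted by 3 into a finite type to which the
    pigeonhole principle applies. *)
Lemma gaussian_int_bounded (z : R[i]) : z \in gaussian_int -> `|z| <= 3 ->
  exists e : 'I_7 * 'I_7, z = Complex (e.1%:R - 3) (e.2%:R - 3).
Proof.
case: z => a b /andP[/= ia ib] z3.
have ab : a ^+ 2 + b ^+ 2 <= 9.
  rewrite -lecR (add_Re2_Im2 (Complex a b)).
  have -> : (9 : R)%:C%C = 3 ^+ 2 :> R[i] by rewrite -natrX rmorph_nat.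
  by rewrite lerXn2r ?nnegrE.
have H (x : R) : x \is a Num.int -> x ^+ 2 <= 9 -> exists e : 'I_7, x = e%:R - 3.
  move=> ix x9; have /natrP[n En] : x + 3 \is a Num.nat.
    by rewrite natrEint rpredD //=; nra.
  have n7 : (n < 7)%N by rewrite -(ltr_nat R) -En; nra.
  by exists (Ordinal n7); rewrite /= -En addrK.
have a0 := sqr_ge0 a; have b0 := sqr_ge0 b.
have [|e ->] := H a ia; first lra.
have [|e' ->] := H b ib; first lra.
by exists (e, e').
Qed.

(** Put [s = l ^+ k * (1 - l ^+ n)] and [t = m ^+ k * (1 - m ^+ n)]. A repetition of two consecutive
    sums gives [2 s + t = 0] and [2 l s + m t = 0]. For [l != m] elimination yields [s = t = 0]; for
    [l = m] the first relation reads [3 s = 0]. *)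
Lemma norm1_power_sums (l m : R[i]) : `|l| = 1 -> `|m| = 1 ->
  (forall k, l ^+ k + m ^+ k + l ^+ k \in gaussian_int) ->
  exists n, [/\ (0 < n)%N, l ^+ n = 1 & m ^+ n = 1].
Proof.
move=> l1 m1 G.
have nz (z : R[i]) k : `|z| = 1 -> z ^+ k != 0.
  by move=> z1; rewrite -normr_eq0 normrX z1 expr1n oner_eq0.
have /choice[e eP] : forall k, exists e : 'I_7 * 'I_7,
    l ^+ k + m ^+ k + l ^+ k = Complex (e.1%:R - 3) (e.2%:R - 3).
  move=> k; apply: gaussian_int_bounded => //.
  rewrite (le_trans (ler_normD _ _)) // (le_trans (lerD (ler_normD _ _) (lexx _))) //.
  rewrite !normrX l1 m1 !expr1n.
  by have -> : 1 + 1 + 1 = 3 :> R[i] by ring.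
(* The pigeonhole principle is applied to pairs of consecutive sums, so that both relations hold for
   the same [k] and [n]. *)
have [k [n [n0 [E1 E2]]]] : exists k n, (0 < n)%N /\
    e k = e (k + n)%N /\ e k.+1 = e (k + n).+1.
  have [k [n [n0 E]]] := pigeonhole (fun k => (e k, e k.+1)).
  by exists k, n; split=> //; case: E => -> ->.
have {}E1 : l ^+ k * (1 - l ^+ n) *+ 2 = - (m ^+ k * (1 - m ^+ n)).
  move: (eP k) (eP (k + n)%N); rewrite -E1 => <-; rewrite !exprD => E.
  apply/eqP; rewrite -subr_eq0; apply/eqP; rewrite -(subrr (l ^+ k + m ^+ k + l ^+ k)) -{2}E.
  by ring.
have {}E2 : l * (l ^+ k * (1 - l ^+ n)) *+ 2 = - (m * (m ^+ k * (1 - m ^+ n))).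
  move: (eP k.+1) (eP (k + n).+1); rewrite -E2 => <-; rewrite !exprS !exprD => E.
  apply/eqP; rewrite -subr_eq0; apply/eqP; rewrite -(subrr (l * l ^+ k + m * m ^+ k + l * l ^+ k)) -{2}E.
  by ring.
exists n.
have [lm|lm] := eqVneq l m.
  subst m; suff /eqP : l ^+ k * (1 - l ^+ n) = 0.
    by rewrite mulf_eq0 (negPf (nz _ _ l1)) subr_eq0 => /eqP/esym ?; split.
  move: E1; move: (_ * _) => t E1.
  have /eqP : t *+ 3 = 0 by rewrite mulrS E1 addrN.
  by rewrite -mulr_natr mulf_eq0 pnatr_eq0 orbF => /eqP.
have lz : l ^+ k * (1 - l ^+ n) = 0.
  apply: (mulIf (_ : (l - m) *+ 2 != 0)).
    by rewrite -mulr_natr mulf_neq0 ?pnatr_eq0 // subr_eq0.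
  rewrite mul0r; move: E1 E2; set s := _ * (1 - l ^+ n); set t := _ * (1 - m ^+ n).
  move=> E1 E2; transitivity (l * s *+ 2 - m * (s *+ 2)); first ring.
  by rewrite E1 E2; ring.
have /eqP mz : m ^+ k * (1 - m ^+ n) = 0.
  by apply/eqP; rewrite -oppr_eq0 -E1 lz mul0rn.
move/eqP: lz mz; rewrite !mulf_eq0 !(negPf (nz _ _ _)) //= !subr_eq0.
by move=> /eqP/esym ? /eqP/esym ?; split.
Qed.
End RootsOfUnity.

Section Dynamics.
Variable R : realType.
Implicit Types (z : nat -> R[i]) (y : 'cV[R[i]]_3).

(** Norms take values in [R[i]]; the Archimedean property comes from [R] through real parts. *)
Lemma complex_archi (c B : R[i]) : 0 < c -> B \is Num.real ->
  exists K, forall k, (K <= k)%N -> B < c * k%:R.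
Proof.
move=> c0 Br; rewrite -(RRe_real Br).
have cr := gtr0_real c0; rewrite -(RRe_real cr).
have {}c0 : 0 < complex.Re c by rewrite -ltcR (RRe_real cr).
pose q := complex.Re B / complex.Re c.
exists (Num.bound `|q|) => k Kk.
rewrite -(rmorph_nat (real_complex R)) -rmorphM ltcR mulrC -ltr_pdivrMr //.
apply: le_lt_trans (ler_norm _) _.
by apply: lt_le_trans (archi_boundP (normr_ge0 q)) _; rewrite ler_nat.
Qed.

(** The linear rate is the one shared by the unipotent case and the expanding case. *)
Definition linear_growth z : Prop :=
  exists c d : R[i], [/\ 0 < c, d \is Num.real
    & forall k, c * k%:R - d <= `|z k|].

(** For [r = 1] the sum is [k]. Otherwise it is [(r ^+ k - 1) / (r - 1)], and Bernoulli's inequality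
    bounds the numerator below. *)
Lemma geometric_norm_ge (r : R[i]) : r = 1 \/ 1 < `|r| ->
  exists2 c : R[i], 0 < c & forall k, c * k%:R <= `|\sum_(i < k) r ^+ i|.
Proof.
case=> [->|r1].
  exists 1 => // k; under eq_bigr do rewrite expr1n.
  by rewrite sumr_const card_ord mul1r normr_nat.
have r0 : 0 < `|r - 1|.
  by rewrite normr_gt0 subr_eq0; apply: contraTneq r1 => ->; rewrite normr1 ltxx.
exists ((`|r| - 1) / `|r - 1|); first by rewrite divr_gt0 ?subr_gt0.
move=> k; rewrite mulrAC ler_pdivrMr // -normrM [X in _ <= `|X|]mulrC -subrX1.
apply: le_trans (lerB_dist _ _); rewrite normr1 normrX.
have r1' : 0 <= `|r| - 1 by rewrite subr_ge0 ltW.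
elim: k => [|k IH]; first by rewrite mulr0 expr0 subrr.
rewrite -natr1 mulrDr mulr1 exprS.
have -> : `|r| * `|r| ^+ k - 1 = (`|r| ^+ k - 1) + (`|r| - 1) * `|r| ^+ k by ring.
by rewrite lerD // ler_peMr // exprn_ege1 // ltW.
Qed.

(** Successive differences form a geometric progression of ratio [r], and the first one is
    nonzero. *)
Lemma affine_recurrence z (r c : R[i]) : r = 1 \/ 1 < `|r| ->
  (forall k, z k.+1 = r * z k + c) -> z 1%N != z 0%N -> linear_growth z.
Proof.
move=> /geometric_norm_ge[d d0 dP] zS z01.
have zE k : z k = z 0%N + (\sum_(i < k) r ^+ i) * (z 1%N - z 0%N).
  elim: k => [|k IH]; first by rewrite big_ord0 mul0r addr0.
  rewrite big_ord_recl expr0; under eq_bigr do rewrite lift0 exprS.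
  by rewrite -mulr_sumr zS IH (zS 0%N); ring.
exists (d * `|z 1%N - z 0%N|), `|z 0%N|; split.
- by rewrite mulr_gt0 // normr_gt0 subr_eq0.
- exact: normr_real.
move=> k; rewrite lerBlDr.
apply: (@le_trans _ _ `|(\sum_(i < k) r ^+ i) * (z 1%N - z 0%N)|).
  by rewrite normrM mulrAC ler_wpM2r.
by rewrite -[X in `|X|](addKr (z 0%N)) -zE (le_trans (ler_normD _ _)) // normrN addrC.
Qed.
End Dynamics.

(** * Orbits of triangular isometries *)

Section NullOrbits.
Variable R : realType.
Implicit Types (y : 'cV[R[i]]_3).

(** In affine coordinates nullity reads [|u|^2 = 2 Re v], at most [2 |v|]. *)
Lemma null_ratio (a b c : R[i]) : a != 0 -> null (cv3 a b c) ->
  `|b / a| ^+ 2 <= `|c / a| *+ 2.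
Proof.
move=> a0 /(null_affine a0)/siegelP /= E.
rewrite normCKC E -[X in _ <= X]ger0_norm ?mulrn_wge0 //.
apply: le_trans (real_ler_norm _) _.
  by rewrite -E -normCKC rpredX // normr_real.
apply: le_trans (ler_normD _ _) _.
by rewrite norm_conjC ger0_norm ?mulrn_wge0 // mulr2n.
Qed.

(** Since [2 |s| <= |s|^2 + 1], only an additive constant is lost. *)
Lemma linear_growth_sq (s t : nat -> R[i]) :
  (forall k, `|s k| ^+ 2 <= `|t k| *+ 2) -> linear_growth s -> linear_growth t.
Proof.
move=> st [c [d [c0 dr sP]]]; exists c, (d + 1); split=> //.
  by rewrite rpredD // real1.
move=> k; rewrite opprD addrA lerBlDr.
apply: le_trans (sP k) _.
rewrite -(@ler_pMn2r _ 2) // mulrnDl.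
apply: (@le_trans _ _ (`|s k| ^+ 2 + 1)); last by rewrite lerD // ler1n.
rewrite -subr_ge0.
have -> : `|s k| ^+ 2 + 1 - `|s k| *+ 2 = (`|s k| - 1) ^+ 2 by ring.
by apply: real_exprn_even_ge0 => //; rewrite rpredB ?normr_real ?real1.
Qed.

(* In the coordinates [(y1 / y2, y0 / y2)] that send the fixed null line to
   infinity, a triangular isometry acts by affine maps. *)
Lemma triangular_orbit (a b c e f i : R[i]) y :
  let T := mx3 a b c 0 e f 0 0 i in
  siegel_unitary T -> null y -> y != 0 ->
  (a / i = 1 /\ e / i = 1) \/ 1 < `|a| ->
  y 2 0 = 0 \/ T *m y <> i *: y ->
  forall d : R[i], 0 < d -> exists K, forall k, (K <= k)%N ->
    (T ^+ k *m y) 0 0 != 0 /\ `|(T ^+ k *m y) 2 0 / (T ^+ k *m y) 0 0| < d.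
Proof.
move=> T uT ny y0 diag fixed d d0.
have [_ _ ai ee _] := siegel_unitary_triangular uT erefl.
have nz (u v : R[i]) : u^* * v = 1 -> u != 0 /\ v != 0.
  move=> uv; split; apply/eqP => z; move: uv; rewrite z ?rmorph0 ?mulr0 ?mul0r;
  by move=> /esym/eqP; rewrite oner_eq0.
have [a0 i0] := nz _ _ ai; have [e0 _] := nz _ _ ee.
pose Y k : 'cV[R[i]]_3 := T ^+ k *m y.
have Y0 : Y 0%N = y by rewrite /Y expr0 mul1mx.
have YS k : Y k.+1 = T *m Y k by rewrite /Y exprS mulmxA.
have YE k : [/\ Y k.+1 0 0 = a * Y k 0 0 + b * Y k 1 0 + c * Y k 2 0,
    Y k.+1 1 0 = e * Y k 1 0 + f * Y k 2 0 & Y k.+1 2 0 = i * Y k 2 0].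
  rewrite YS; have [p [q [r ->]]] := cv3P (Y k).
  by rewrite mul_mx3_cv3 !mxE /=; split; ring.
have nY k : null (Y k) by apply: siegel_unitary_null => //; exact: siegel_unitaryX.
have eqY k : Y k = cv3 (Y k 0 0) (Y k 1 0) (Y k 2 0).
  by have [p [q [r ->]]] := cv3P (Y k); rewrite !mxE.
(* If [y 2 0] vanishes, nullity puts [y] on the fixed line, and the ratio is 0 from the start. *)
have [y20|y20] := eqVneq (y 2 0) 0.
  have Y2 k : Y k 2 0 = 0.
    elim: k => [|k IH]; first by rewrite Y0.
    by have [_ _ ->] := YE k; rewrite IH mulr0.
  have Y1 k : Y k 1 0 = 0.
    have := nY k; rewrite {1}eqY Y2 => /nullP; rewrite mulr0 rmorph0 mul0r addr0 => /eqP.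
    by rewrite mulf_eq0 conjC_eq0 orbb => /eqP.
  have Yk k : Y k 0 0 != 0.
    elim: k => [|k IH]; last first.
      by have [-> _ _] := YE k; rewrite Y1 Y2 !mulr0 !addr0 mulf_neq0.
    rewrite Y0; apply: contraNneq y0 => y00; rewrite -Y0 eqY Y1 Y2 Y0 y00.
    by apply/eqP/matrixP => -[[|[|[|]]] // hi] [[|//] hj]; rewrite !mxE.
  by exists 0%N => k _; rewrite -/(Y k) Y2 mul0r normr0.
have {}fixed : T *m y <> i *: y by case: fixed => // /eqP; rewrite (negPf y20).
have Y2 k : Y k 2 0 != 0.
  elim: k => [|k IH]; first by rewrite Y0.
  by have [_ _ ->] := YE k; rewrite mulf_neq0.
pose s k := Y k 1 0 / Y k 2 0; pose t k := Y k 0 0 / Y k 2 0.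
have sS k : s k.+1 = (e / i) * s k + f / i.
  rewrite /s; have [_ -> ->] := YE k; field; rewrite i0; exact: Y2.
have tS k : t k.+1 = (a / i) * t k + ((b / i) * s k + c / i).
  rewrite /t /s; have [-> _ ->] := YE k; field; rewrite i0; exact: Y2.
have iE : i^-1 = a^*.
  by rewrite -[RHS]mulr1 -(mulfV i0) mulrA ai mul1r.
have e1 : `|e| = 1 by apply/eqP; rewrite -sqrp_eq1 // normCKC ee.
have diagE : e / i = 1 \/ 1 < `|e / i|.
  case: diag => [[_ ->]|a1]; [by left | right].
  by rewrite iE normrM e1 mul1r norm_conjC.
have diagA : a / i = 1 \/ 1 < `|a / i|.
  case: diag => [[-> _]|a1]; [by left | right].
  by rewrite iE normrM norm_conjC mulr_egt1.
have growth : linear_growth t.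
  (* If [s] moves, it grows, and nullity, which is symmetric in the outer coordinates, makes [t]
     grow too. If [s] is stationary, [t] obeys a scalar affine recurrence. *)
  have [s10|s10] := eqVneq (s 1%N) (s 0%N); last first.
    apply: linear_growth_sq (affine_recurrence diagE sS s10) => k.
    apply: null_ratio (Y2 k) _; apply/nullP.
    by have := nY k; rewrite {1}eqY => /nullP ->; ring.
  have sC k : s k = s 0%N by elim: k => // k IH; rewrite sS IH -sS.
  apply: affine_recurrence diagA _ _ => [k|]; first by rewrite tS sC.
  (* If [t] were stationary as well, [y] would be an eigenvector for [i]. *)
  apply/eqP => t10; apply: fixed.
  have [_ _ E2] := YE 0%N.
  move: s10 t10; rewrite /s /t E2 => /(congr1 (fun z => z * (i * Y 0%N 2 0))) E1.
  move=> /(congr1 (fun z => z * (i * Y 0%N 2 0))) E0.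
  have iY : i * Y 0%N 2 0 != 0 by rewrite mulf_neq0.
  move: E1 E0; rewrite !divfK // => E1 E0.
  rewrite -Y0 -YS eqY E0 E1 E2 [in RHS]eqY scale_cv3.
  by congr cv3; field; exact: Y2.
have [c' [d' [c0 dr tP]]] := growth.
have Br : d^-1 + d' \is Num.real by rewrite rpredD // rpredV gtr0_real.
(* Beyond [K] the norm of [t k] exceeds [d^-1], and the ratio to be bounded is the inverse of
   [t k]. *)
have [K KP] := complex_archi c0 Br.
exists K => k /KP; rewrite -ltrBrDr => /lt_le_trans/(_ (tP k)) tk.
have t0 : 0 < `|t k| by apply: lt_trans tk; rewrite invr_gt0.
have Yk : Y k 0 0 != 0.
  by move: t0; rewrite normr_gt0; apply: contra_neq => y00; rewrite /t y00 mul0r.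
split=> //; rewrite -/(Y k) -invf_div normfV -/(t k).
by rewrite -[d]invrK ltf_pV2 // posrE // invr_gt0.
Qed.
End NullOrbits.

(** * Convergents as projective points *)

Section ContinuedFractions.
Variable R : realType.
Implicit Types (p q h : R[i] * R[i]) (g : nat -> R[i] * R[i]).
Implicit Types (M : 'M[R[i]]_3) (x : 'cV[R[i]]_3).

Definition infty : 'cV[R[i]]_3 := cv3 0 0 1.

Lemma infty_null : null infty.
Proof. by apply/nullP; rewrite rmorph0; ring. Qed.

Lemma siegel_unitary_neq0 M : siegel_unitary M -> M *m infty != 0.
Proof.
move=> /siegel_unitary_unit uM; apply/eqP => /(congr1 (mulmx (invmx M))).
rewrite mulKmx // mulmx0 => /matrixP/(_ 2 0); rewrite !mxE /= => /eqP.
by rewrite oner_eq0.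
Qed.

Lemma affine_point_heis_mx p x :
  affine_point (heis_mx p *m x) = heis_act p (affine_point x).
Proof.
have [a [b [c ->]]] := cv3P x; rewrite mul_mx3_cv3 /affine_point !mxE /=.
rewrite mul1r !mul0r !addr0; case: eqVneq => //= a0; rewrite /heis_mul /=.
by congr (Some (_, _)); field.
Qed.

Lemma affine_point_koranyi_mx x : null x -> x != 0 ->
  affine_point (koranyi_mx R *m x) = koranyi (affine_point x).
Proof.
move=> nx; have x10 := null_infty nx; move: nx x10.
have [a [b [c ->]]] := cv3P x; rewrite mul_mx3_cv3 /affine_point !mxE /=.
rewrite !mul0r !mul1r !add0r !addr0 mulN1r => nx x10 x0.
have [a0|a0] := eqVneq a 0.
  (* Nullity leaves only the point at infinity here, whose image is the origin. *)
  rewrite x10 // oppr0 a0 !mul0r.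
  case: eqVneq => // c0; case/eqP: x0.
  by rewrite a0 x10 // c0; apply/matrixP => -[[|[|[|]]] // hi] [[|//] hj]; rewrite !mxE.
rewrite /= mulf_eq0 invr_eq0 (negPf a0) orbF.
by case: eqVneq => // c0; congr (Some (_, _)); field; rewrite a0.
Qed.

Lemma mkseq_add (T : Type) (f : nat -> T) m n :
  mkseq f (m + n) = mkseq f m ++ mkseq (fun i => f (m + i)%N) n.
Proof. by rewrite /mkseq iotaD map_cat add0n -{2}[m]addn0 iotaDl -map_comp. Qed.

Lemma mkseq_siegel_int g n : (forall i, g i \in siegel_int) ->
  {in mkseq g n, forall p, p \in siegel_int}.
Proof. by move=> gS p /mapP[i _ ->]. Qed.

(** The final inversion of the word sends infinity to the origin, which the last letter translates
    to [g n]; hence the [n.+1] letters. *)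
Lemma cfrac_affine g n : (forall i, g i \in siegel_int) ->
  cfrac g n = affine_point (cfrac_mx (mkseq g n.+1) *m infty).
Proof.
elim: n g => [|n IH] g gS.
  rewrite /= mulmx1 -mulmxA affine_point_heis_mx affine_point_koranyi_mx.
  - by rewrite /affine_point !mxE /= eqxx /= /heis_mul /= mulr0 !addr0; case: (g 0%N).
  - exact: infty_null.
  - by have := siegel_unitary_neq0 (siegel_unitary1 R); rewrite mul1mx.
have -> : mkseq g n.+2 = g 0%N :: mkseq (fun i => g i.+1) n.+1.
  exact: (mkseq_add g 1 n.+1).
rewrite [LHS]/= IH //; set s := mkseq _ n.+1.
have [_ uN] : gaussian_unitary (cfrac_mx s).
  by apply: gaussian_unitary_cfrac_mx; apply: mkseq_siegel_int.
have nN := siegel_unitary_null uN infty_null.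
clearbody s; rewrite /= -!mulmxA affine_point_heis_mx.
by rewrite (affine_point_koranyi_mx nN (siegel_unitary_neq0 uN)).
Qed.

Lemma cfrac_expansion_eps g h :
  (forall e : R[i], 0 < e -> exists N, forall n, (N <= n)%N ->
    exists p, [/\ cfrac g n = Some p, `|h.1 - p.1| < e & `|h.2 - p.2| < e]) ->
  cfrac_expansion g h.
Proof.
(* The default 0 is taken only at convergents equal to infinity, all of which have index below some
   bound. *)
move=> H; pose x n : R[i]^o * R[i]^o := odflt 0 (cfrac g n).
exists x; split.
  have [N NP] := H 1 ltr01; exists N => // n /= Nn.
  by rewrite /x; have [p [-> _ _]] := NP n Nn.
have -> : x = fun n => ((x n).1, (x n).2) by apply/funext => n; case: (x n).
have -> : (h : R[i]^o * R[i]^o) = (h.1, h.2) by case: (h).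
have c1 : ((fun n => (x n).1) @ \oo --> (h.1 : R[i]^o))%classic.
  apply/cvgrPdist_lt => e e0; have [N NP] := H e e0.
  by exists N => // n /= Nn; rewrite /x; have [p [-> ? ?]] := NP n Nn.
have c2 : ((fun n => (x n).2) @ \oo --> (h.2 : R[i]^o))%classic.
  apply/cvgrPdist_lt => e e0; have [N NP] := H e e0.
  by exists N => // n /= Nn; rewrite /x; have [p [-> ? ?]] := NP n Nn.
exact: cvg_pair c1 c2.
Qed.

Lemma cfrac_expansionP g h : cfrac_expansion g h ->
  exists (x : nat -> R[i] * R[i]) N, (forall n, (N <= n)%N -> cfrac g n = Some (x n)) /\
   ((fun n => (x n).1 : R[i]^o) @ \oo --> (h.1 : R[i]^o))%classic /\
   ((fun n => (x n).2 : R[i]^o) @ \oo --> (h.2 : R[i]^o))%classic.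
Proof.
move=> [x [[N _ NP] xh]]; exists x, N; split=> //; split.
  apply: (cvg_comp x fst xh); exact: cvg_fst.
apply: (cvg_comp x snd xh); exact: cvg_snd.
Qed.

(** On the model a small second coordinate forces a small first one, and translation by [h] carries
    a neighbourhood of the origin to one of [h]. *)
Lemma heis_affine_close h (e : R[i]) : 0 < e ->
  exists2 d : R[i], 0 < d & forall x, null x -> x 0 0 != 0 ->
    `|x 2 0 / x 0 0| < d -> exists p, [/\ affine_point (heis_mx h *m x) = Some p,
      `|h.1 - p.1| < e & `|h.2 - p.2| < e].
Proof.
(* The constant [k] is below 1 and below [e], and [k * (|h.1| + 1) < e] absorbs the twist of the
   translation. *)
move=> e0; pose D := `|h.1| + 1 + e; pose k := e / D.
have D0 : 0 < D by rewrite addr_gt0 // ltr_wpDl.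
have k0 : 0 < k by rewrite divr_gt0.
have kD : k * D = e by rewrite /k divfK // gt_eqF.
have ke : k * (`|h.1| + 1) < e.
  by rewrite -[X in _ < X]kD ltr_pM2l // ltrDl.
have k1 : k < 1 by rewrite ltr_pdivrMr // mul1r ltrDr ltr_wpDl.
have ke' : k < e.
  by apply: le_lt_trans ke; rewrite ler_peMr ?(ltW k0) // lerDr.
exists (k ^+ 2 / 2); first by rewrite divr_gt0 // exprn_gt0.
move=> x; have [a [b [c ->]]] := cv3P x; rewrite !mxE /= => nx a0 xd.
rewrite affine_point_heis_mx /affine_point !mxE /= (negPf a0) /=.
have ba : `|b / a| < k.
  rewrite -(@ltr_pXn2r _ 2) ?nnegrE ?(ltW k0) //.
  apply: le_lt_trans (null_ratio a0 nx) _.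
  by rewrite -mulr_natr -ltr_pdivlMr.
have ca : `|c / a| < k.
  apply: lt_le_trans xd _; rewrite ler_pdivrMr // expr2 ler_pM2l //.
  by rewrite (le_trans (ltW k1)) // ler1n.
have S : `|h.1| * `|b / a| + `|c / a| < e.
  apply: le_lt_trans ke; rewrite mulrDr mulr1 lerD ?(ltW ca) //.
  by rewrite [leRHS]mulrC ler_wpM2l // ltW.
have dist (u v : R[i]) : `|u - (u + v)| = `|v|.
  by rewrite opprD addrA subrr add0r normrN.
exists (heis_mul h (b / a, c / a)); split=> //=.
  by rewrite dist (lt_trans ba).
rewrite -addrA dist; apply: le_lt_trans S.
by rewrite -(norm_conjC h.1) -normrM ler_normD.
Qed.
End ContinuedFractions.

(** * Periodic expansions from triangular isometries *)

Section PeriodicExpansions.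
Variable R : realType.
Implicit Types (p q h : R[i] * R[i]) (g : nat -> R[i] * R[i]).
Implicit Types (M N P : 'M[R[i]]_3) (x y : 'cV[R[i]]_3).
Local Notation infty := (infty R).

Lemma triangularX (a b c e f i : R[i]) n : exists b' c' f',
  mx3 a b c 0 e f 0 0 i ^+ n = mx3 (a ^+ n) b' c' 0 (e ^+ n) f' 0 0 (i ^+ n).
Proof.
elim: n => [|n [b' [c' [f' IH]]]].
  by exists 0, 0, 0; rewrite !expr0 -[1]/(1%:M) mx3_1.
exists (a * b' + b * e ^+ n), (a * c' + b * f' + c * i ^+ n), (e * f' + f * i ^+ n).
by rewrite !exprS IH -mulmxE mul_mx3; congr mx3; ring.
Qed.

Lemma conj_mxX M (A B : 'M[R[i]]_3) n : A *m B = 1%:M -> (A *m M *m B) ^+ n = A *m M ^+ n *m B.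
Proof.
move=> AB; have BA := mulmx1C AB.
elim: n => [|n IH]; first by rewrite !expr0 mulmx1 AB.
by rewrite !exprS IH -!mulmxE !mulmxA -(mulmxA _ B A) BA mulmx1.
Qed.

(** Conjugation by [P] moves the eigenvector to infinity, and the eigenvalue becomes a diagonal
    entry, a Gaussian unit. *)
Lemma gaussian_eigenvalue_norm1 N P (v : R[i]) :
  gaussian_unitary N -> gaussian_unitary P ->
  N *m (P *m infty) = v *: (P *m infty) -> `|v| = 1.
Proof.
move=> gN gP E; pose Q := invmx P *m (N *m P).
have gQ : gaussian_unitary Q.
  by apply: gaussian_unitaryM (gaussian_unitaryV gP) _; apply: gaussian_unitaryM.
have : Q *m infty = cv3 0 0 v.
  rewrite /Q -!mulmxA E -scalemxAr mulKmx; last exact: siegel_unitary_unit gP.2.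
  by rewrite scale_cv3 !mulr0 mulr1.
have [_ ->] := gaussian_unitary_last_col gQ => /cv3_inj[Q02 _ Q22].
have [p [a [b [_ [_ a1] _ EQ]]]] := cfrac_mx_stab_infty gQ Q02.
rewrite -a1 -Q22 EQ mul_mx3 !mxE /=.
by congr `|_|; ring.
Qed.

(** The second coordinate of the fixed vector gives [f = 0], unitarity then gives [b = 0], and the
    first coordinate gives [c = 0]. *)
Lemma unipotent_fixed_point (b c f : R[i]) y :
  let T := mx3 1 b c 0 1 f 0 0 1 in
  siegel_unitary T -> y 2 0 != 0 -> T *m y = y -> T = 1%:M.
Proof.
have [p [q [r ->]]] := cv3P y => T uT; rewrite mxE /= => r0.
rewrite /T mul_mx3_cv3 => /cv3_inj[E0 E1 _].
have [_ _ _ _ E] := siegel_unitary_triangular uT erefl.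
have f0 : f = 0.
  by apply: (mulIf r0); rewrite -[LHS](addKr q) mul0r; rewrite -[X in - X + _]E1; ring.
have b0 : b = 0.
  by apply/eqP; rewrite -conjC_eq0; move: E; rewrite f0 mulr0 mulr1 => <-.
have c0 : c = 0.
  apply: (mulIf r0); rewrite -[LHS](addKr p) mul0r -[X in - X + _]E0 b0; ring.
by rewrite mx3_1 b0 c0 f0.
Qed.

Definition periodic_seq (s : seq (R[i] * R[i])) n := nth 0 s (n %% size s).

Lemma periodic_seq_mkseq (s : seq (R[i] * R[i])) k j :
  mkseq (periodic_seq s) (k * size s + j) =
  flatten (nseq k s) ++ mkseq (periodic_seq s) j.
Proof.
elim: k => //= k IH; rewrite mulSn -addnA mkseq_add -catA -IH; congr (_ ++ _).
  rewrite -[RHS](mkseq_nth 0); apply/eq_in_map => i.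
  by rewrite mem_iota /= add0n => ?; rewrite /periodic_seq modn_small.
by apply: eq_mkseq => i; rewrite /periodic_seq modnDl.
Qed.

Lemma cfrac_mx_flatten (s : seq (R[i] * R[i])) k : cfrac_mx (flatten (nseq k s)) = cfrac_mx s ^+ k.
Proof. by elim: k => //= k IH; rewrite cfrac_mx_cat IH exprS. Qed.

(** Each convergent is a power of the period applied to one of finitely many initial segments [t],
    so convergence along every segment is uniform. *)
Lemma periodic_expansion_converges h (s : seq (R[i] * R[i])) : (0 < size s)%N ->
  {in s, forall p, p \in siegel_int} ->
  (forall (t : seq (R[i] * R[i])) (d : R[i]), {in t, forall p, p \in siegel_int} -> 0 < d ->
    exists K, forall k, (K <= k)%N ->
    exists p, [/\ affine_point (cfrac_mx s ^+ k *m (cfrac_mx t *m infty)) = Some p,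
      `|h.1 - p.1| < d & `|h.2 - p.2| < d]) ->
  exists g : nat -> R[i] * R[i], (forall i, g i \in siegel_int) /\
    eventually_periodic g /\ cfrac_expansion g h.
Proof.
move=> s0 sS H; pose g := periodic_seq s; exists g.
have gS i : g i \in siegel_int by apply: sS; rewrite mem_nth // ltn_mod.
split=> //; split.
  by exists 0%N, (size s); split=> // n _; rewrite /g /periodic_seq modnDr.
apply: cfrac_expansion_eps => e e0.
have /choice[K KP] : forall j, exists K, forall k, (K <= k)%N ->
    exists p, [/\ affine_point (cfrac_mx s ^+ k *m (cfrac_mx (mkseq g j.+1) *m infty))
      = Some p, `|h.1 - p.1| < e & `|h.2 - p.2| < e].
  by move=> j; apply: H => //; apply: mkseq_siegel_int.
(* The largest threshold over all remainders, converted from periods to letters. *)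
exists ((\max_(j < size s) K j) * size s)%N => n Nn.
have lt_mod : (n %% size s < size s)%N by rewrite ltn_mod.
have [|p [Ep p1 p2]] := KP (n %% size s)%N (n %/ size s)%N.
  apply: leq_trans (@leq_bigmax _ (fun j : 'I_(size s) => K j) (Ordinal lt_mod)) _.
  by rewrite leq_divRL.
exists p; split=> //; rewrite -Ep cfrac_affine //.
rewrite {1}(divn_eq n (size s)) -addnS periodic_seq_mkseq cfrac_mx_cat.
by rewrite cfrac_mx_flatten mulmxA.
Qed.

Lemma periodic_expansion_triangular M h (a b c e f i : R[i]) :
  h \in siegel -> gaussian_unitary M -> not_root_of_unity M ->
  heis_mx (heis_inv h) *m M *m heis_mx h = mx3 a b c 0 e f 0 0 i ->
  1 <= `|a| ->
  exists g : nat -> R[i] * R[i], (forall i, g i \in siegel_int) /\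
    eventually_periodic g /\ cfrac_expansion g h.
Proof.
move=> hS gM nM ET a1.
have HV := heis_mxVl hS; have HV' := heis_mxVr hS.
have uH := siegel_unitary_heis_mx hS.
have uH' : siegel_unitary (heis_mx (heis_inv h)).
  exact/siegel_unitary_heis_mx/siegel_inv.
have EX n : heis_mx (heis_inv h) *m M ^+ n *m heis_mx h
    = mx3 a b c 0 e f 0 0 i ^+ n by rewrite -ET conj_mxX.
have uT : siegel_unitary (mx3 a b c 0 e f 0 0 i).
  by rewrite -ET; apply: siegel_unitary_heis_conj gM.2.
have [_ _ ai ee _] := siegel_unitary_triangular uT erefl.
have e1 : `|e| = 1 by apply/eqP; rewrite -sqrp_eq1 // normCKC ee.
have [m [m0 diag]] : exists m, (0 < m)%N /\
    ([/\ a ^+ m = 1, e ^+ m = 1 & i ^+ m = 1] \/ 1 < `|a ^+ m|).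
  move: a1; rewrite le_eqVlt => /orP[/eqP/esym a1|a1]; last first.
    by exists 1%N; split=> //; right.
  have ia : i = a.
    apply: (@mulfI _ a^*); last by rewrite ai -normCKC a1 expr1n.
    by rewrite conjC_eq0 -normr_eq0 a1 oner_eq0.
  (* Conjugation preserves traces, so the [k]-th sum is the trace of [M ^+ k], a Gaussian
     integer. *)
  have [k|m [m0 am em]] := norm1_power_sums a1 e1.
    have [b' [c' [f' E]]] := triangularX a b c e f i k.
    move: (EX k); rewrite E => /(congr1 mxtrace).
    rewrite mx3_trace ia mxtrace_mulC mulmxA HV' mul1mx => <-.
    by rewrite rpred_sum // => j _; apply: (mxOverP (gaussian_unitaryX k gM).1).
  by exists m; split=> //; left; split; rewrite ?ia.
(* The factor 4 makes [M ^+ n] a word without a diagonal factor. *)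
pose n := (4 * m)%N.
have n0 : (0 < n)%N by rewrite muln_gt0.
have {}diag : [/\ a ^+ n = 1, e ^+ n = 1 & i ^+ n = 1] \/ 1 < `|a ^+ n|.
  rewrite /n mulnC !exprM; case: diag => [[-> -> ->]|am]; rewrite ?expr1n; first by left.
  by right; rewrite normrX exprn_egt1.
have [s sS EW] := gaussian_unitaryX_cfrac m gM; rewrite -/n in EW.
have [b' [c' [f' En]]] := triangularX a b c e f i n.
have {uT}uTn := siegel_unitaryX n uT; rewrite En in uTn.
have {EX}Tn := EX n; rewrite En EW in Tn.
have [_ _ ani een _] := siegel_unitary_triangular uTn erefl.
have Wn1 : cfrac_mx s != 1%:M by rewrite -EW; apply/eqP; apply: nM.
apply: (@periodic_expansion_converges h s) => //.
  by case: s Wn1 {EW Tn sS} => //=; rewrite eqxx.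
move=> t d tS d0.
have gP := gaussian_unitary_cfrac_mx tS; have nP := siegel_unitary_null gP.2 (infty_null R).
set x := cfrac_mx t *m infty in nP *.
pose y := heis_mx (heis_inv h) *m x.
have ny : null y by exact: siegel_unitary_null.
have Ex : x = heis_mx h *m y by rewrite /y mulmxA HV' mul1mx.
have y0 : y != 0.
  apply/eqP => y0; have := siegel_unitary_neq0 gP.2.
  by rewrite -/x Ex y0 mulmx0 eqxx.
have Wx v : mx3 (a ^+ n) b' c' 0 (e ^+ n) f' 0 0 (i ^+ n) *m y = v *: y ->
    cfrac_mx s *m x = v *: x.
  rewrite -Tn /y -!mulmxA (mulmxA (heis_mx h)) HV' mul1mx => E.
  have := congr1 (mulmx (heis_mx h)) E.
  by rewrite -!scalemxAr !mulmxA HV' !mul1mx.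
(* A second fixed point would make a unipotent word trivial, against [Wn1]; in the expanding case
   its eigenvalue [i ^+ n] would have norm 1, and then so would [a ^+ n]. *)
have fixed : y 2 0 = 0 \/ mx3 (a ^+ n) b' c' 0 (e ^+ n) f' 0 0 (i ^+ n) *m y <> i ^+ n *: y.
  have [y2|y2] := eqVneq (y 2 0) 0; [by left | right => E].
  case: diag => [[an en i_n]|an].
    move: uTn E Tn; rewrite an en i_n scale1r => uTn E Tn.
    have T1 := unipotent_fixed_point uTn y2 E; case/eqP: Wn1.
    move: Tn; rewrite T1 => /(congr1 (fun X => heis_mx h *m X *m heis_mx (heis_inv h))).
    by rewrite !mulmxA HV' mul1mx mulmx1 HV' -mulmxA HV' mulmx1.
  have gW : gaussian_unitary (cfrac_mx s) by rewrite -EW; exact: gaussian_unitaryX.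
  have := gaussian_eigenvalue_norm1 gW gP (Wx _ E) => in1.
  move: an; have /(congr1 Num.norm) := ani; rewrite normrM norm_conjC in1 mulr1 normr1 => ->.
  by rewrite ltxx.
have diag' : (a ^+ n / i ^+ n = 1 /\ e ^+ n / i ^+ n = 1) \/ 1 < `|a ^+ n|.
  by case: diag => [[-> -> ->]|?]; [left; rewrite divr1 | right].
have [d' d'0 close] := heis_affine_close h d0.
have [K KP] := triangular_orbit uTn ny y0 diag' fixed d'0.
exists K => k /KP[]; rewrite -Tn => z0 zd.
have {close} := close _ (siegel_unitary_null _ ny) z0 zd.
rewrite conj_mxX // -!mulmxA -Ex (mulmxA (heis_mx h)) HV' mul1mx; apply.
apply: siegel_unitaryM => //; apply: siegel_unitaryM => //.
by apply: siegel_unitaryX; rewrite -EW; apply: siegel_unitaryX; exact: gM.2.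
Qed.
End PeriodicExpansions.

(** * Matrices from periodic expansions *)

(** The equations of the projective action are cross-multiplied, so no denominator has to be
    controlled in the limit. *)
Lemma projective_limit (K : numFieldType) (x1 x2 : nat -> K) (T : nat)
    (h1 h2 a b c d e f g k i : K) :
  (x1 @ \oo --> h1)%classic -> (x2 @ \oo --> h2)%classic ->
  (forall n, d + e * x1 n + f * x2 n = (a + b * x1 n + c * x2 n) * x1 (n + T)%N /\
             g + k * x1 n + i * x2 n = (a + b * x1 n + c * x2 n) * x2 (n + T)%N) ->
  d + e * h1 + f * h2 = (a + b * h1 + c * h2) * h1 /\
  g + k * h1 + i * h2 = (a + b * h1 + c * h2) * h2.
Proof.
move=> x1h x2h E.
have shift (x : nat -> K) l : (x @ \oo --> l)%classic ->
    ((fun n => x (n + T)%N) @ \oo --> l)%classic.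
  by move=> xl; apply: cvg_comp xl; exact: cvg_addnr.
have lin (u v w : K) : ((fun n => u + v * x1 n + w * x2 n) @ \oo
    --> u + v * h1 + w * h2)%classic.
  by apply: cvgD; [apply: cvgD; [exact: cvg_cst | exact: cvgMr] | exact: cvgMr].
have mul_lin (x : nat -> K) l u v w : (x @ \oo --> l)%classic ->
    (forall n, u + v * x1 n + w * x2 n = (a + b * x1 n + c * x2 n) * x (n + T)%N) ->
    u + v * h1 + w * h2 = (a + b * h1 + c * h2) * l.
  move=> /shift xl Ex; have L := lin u v w.
  rewrite (funext Ex) in L.
  exact: norm_cvg_unique L (cvgM (lin a b c) xl).
by split; [apply: mul_lin x1h _ | apply: mul_lin x2h _] => n; case: (E n).
Qed.

Section EventuallyPeriodic.
Variable R : realType.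
Implicit Types (p q h : R[i] * R[i]) (g : nat -> R[i] * R[i]).
Implicit Types (M : 'M[R[i]]_3) (x y : 'cV[R[i]]_3).
Local Notation infty := (infty R).

Lemma affine_pointE y p : affine_point y = Some p ->
  exists2 c, c != 0 & y = c *: siegel_vec p.
Proof.
rewrite /affine_point; have [a [b [c ->]]] := cv3P y; rewrite !mxE /=.
case: eqVneq => // a0 [<-]; exists a => //.
by rewrite siegel_vecE scale_cv3 /=; congr cv3; field.
Qed.

Lemma siegel_vec_origin h : siegel_vec h = heis_mx h *m cv3 1 0 0.
Proof. by rewrite siegel_vecE mul_mx3_cv3; congr cv3; ring. Qed.

(** Exhibits a convergent and its predecessor as images of a finite point and of infinity under the
    same matrix. *)
Lemma cfrac_mx_mkseqS g n :
  cfrac_mx (mkseq g n.+1) *m infty = cfrac_mx (mkseq g n) *m siegel_vec (g n).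
Proof.
rewrite mkseqS -cats1 cfrac_mx_cat -mulmxA; congr (_ *m _).
rewrite /= mulmx1 -mulmxA mul_mx3_cv3 siegel_vec_origin; congr (_ *m _).
by congr cv3; ring.
Qed.

Lemma orbit_limit_fixed M (y : nat -> 'cV[R[i]]_3) (x : nat -> R[i] * R[i]) h T :
  (forall n, affine_point (y n) = Some (x n)) ->
  (forall n, y (n + T)%N = M *m y n) ->
  ((fun n => (x n).1 : R[i]^o) @ \oo --> (h.1 : R[i]^o))%classic ->
  ((fun n => (x n).2 : R[i]^o) @ \oo --> (h.2 : R[i]^o))%classic ->
  exists l, M *m siegel_vec h = l *: siegel_vec h.
Proof.
move=> yx yT x1 x2.
have E n : exists2 c : R[i], c != 0 & exists2 c', c' != 0 &
    c *: (M *m siegel_vec (x n)) = c' *: siegel_vec (x (n + T)%N).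
  have [r r0 rE] := affine_pointE (yx n).
  have [s s0 sE] := affine_pointE (yx (n + T)%N).
  exists r => //; exists s => //.
  by rewrite scalemxAr -rE -sE yT.
have [a [b [c [d [e [f [g [k [i EM]]]]]]]]] := mx3P M.
have {}E n : d + e * (x n).1 + f * (x n).2
      = (a + b * (x n).1 + c * (x n).2) * (x (n + T)%N).1
    /\ g + k * (x n).1 + i * (x n).2
      = (a + b * (x n).1 + c * (x n).2) * (x (n + T)%N).2.
  have [r r0 [s s0]] := E n.
  rewrite EM !siegel_vecE mul_mx3_cv3 !scale_cv3 !mulr1 => /cv3_inj[E0 E1 E2].
  by split; apply: (mulfI r0); rewrite mulrA E0 ?E1 ?E2.
have [E1 E2] := projective_limit x1 x2 E.
(* The first coordinate of [siegel_vec h] is 1, so the eigenvalue is the first coordinate of its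
   image. *)
exists (a + b * h.1 + c * h.2).
by rewrite EM !siegel_vecE mul_mx3_cv3 !scale_cv3 !mulr1 E1 E2.
Qed.

(** Each value recurs along an arithmetic progression of indices, hence equals the limit. *)
Lemma periodic_limit_constant (x : nat -> R[i] * R[i]) h T : (0 < T)%N ->
  ((fun n => (x n).1 : R[i]^o) @ \oo --> (h.1 : R[i]^o))%classic ->
  ((fun n => (x n).2 : R[i]^o) @ \oo --> (h.2 : R[i]^o))%classic ->
  (forall n, x (n + T)%N = x n) -> forall n, x n = h.
Proof.
move=> T0 x1 x2 xT n.
have xk k : x (n + k * T)%N = x n.
  by elim: k => [|k IH]; rewrite ?addn0 // mulSnr addnA xT.
have lim (z : nat -> R[i]) l : ((z : nat -> R[i]^o) @ \oo --> (l : R[i]^o))%classic ->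
    (forall k, z (n + k * T)%N = z n) -> z n = l.
  move=> /cvgrPdist_lt zl zk; apply/eqP; rewrite eq_sym -subr_eq0 -normr_eq0.
  apply/negPn/negP => ne; have e0 : 0 < `|l - z n| by rewrite lt_neqAle eq_sym ne normr_ge0.
  have [K _ KP] := zl _ e0.
  have /KP : (K <= n + K * T)%N by rewrite (leq_trans (leq_pmulr K T0)) ?leq_addl.
  by rewrite /= zk ltxx.
rewrite [LHS]surjective_pairing [RHS]surjective_pairing; congr (_, _).
  by apply: (lim _ _ x1) => k; rewrite xk.
by apply: (lim _ _ x2) => k; rewrite xk.
Qed.

Lemma periodic_expansion_matrix g h :
  (forall i, g i \in siegel_int) -> eventually_periodic g -> cfrac_expansion g h ->
  exists M, [/\ gaussian_unitary M, not_root_of_unity M &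
    exists l, M *m siegel_vec h = l *: siegel_vec h].
Proof.
move=> gS [N [T [T0 gT]]] /cfrac_expansionP[x [N1 [xP [x1 x2]]]].
pose A := cfrac_mx (mkseq g N); pose B := cfrac_mx (mkseq (fun i => g (N + i)%N) T).
have gA : gaussian_unitary A by apply: gaussian_unitary_cfrac_mx; exact: mkseq_siegel_int.
have gB : gaussian_unitary B by apply: gaussian_unitary_cfrac_mx; exact: mkseq_siegel_int.
(* [A] reads the preperiod and [B] one period, so [M] inserts a period after the preperiod. *)
pose M := A *m B *m invmx A.
have gM : gaussian_unitary M.
  by apply: gaussian_unitaryM (gaussian_unitaryV gA); exact: gaussian_unitaryM.
pose P n := cfrac_mx (mkseq g (N + n).+1).
have PT n : P (n + T)%N = M *m P n.
  have mk m : (N + m).+1 = (N + m.+1)%N by lia.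
  have nT : (n + T).+1 = (T + n.+1)%N by lia.
  rewrite /P !mk nT !mkseq_add !cfrac_mx_cat.
  rewrite /M -!mulmxA mulKmx; last exact: siegel_unitary_unit gA.2.
  congr (_ *m (_ *m cfrac_mx _)); apply: eq_mkseq => i.
  by rewrite addnCA addnC gT // leq_addr.
have uP n : siegel_unitary (P n).
  by apply: (gaussian_unitary_cfrac_mx _).2; exact: mkseq_siegel_int.
(* Indices start past the preperiod and past [N1], from where all convergents are finite. *)
pose y n := P (N1 + n)%N *m infty; pose X n := x (N + (N1 + n))%N.
have yX n : affine_point (y n) = Some (X n).
  by rewrite /y -cfrac_affine // xP // addnCA leq_addr.
have yT n : y (n + T)%N = M *m y n by rewrite /y addnA PT mulmxA.
have cvgN (z : nat -> R[i]^o) (l : R[i]^o) : (z @ \oo --> l)%classic ->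
    ((fun n => z (N + (N1 + n))%N) @ \oo --> l)%classic.
  move=> zl; apply: (cvg_comp (fun n => (N + (N1 + n))%N) z _ zl).
  by under eq_fun do rewrite addnA; exact: cvg_addnl.
have X1 := cvgN _ _ x1.
have X2 := cvgN _ _ x2.
exists M; split=> //; last exact: (orbit_limit_fixed yX yT X1 X2).
move=> q q0 Mq.
have yq n : y (n + q * T)%N = y n.
  have yk k : y (n + k * T)%N = M ^+ k *m y n.
    elim: k => [|k IH]; first by rewrite addn0 expr0 mul1mx.
    by rewrite mulSnr addnA yT IH exprS mulmxA.
  by rewrite yk Mq mul1mx.
have Xq n : X (n + q * T)%N = X n by apply: Some_inj; rewrite -!yX yq.
have qT0 : (0 < q * T)%N by rewrite muln_gt0 q0.
have Xh := periodic_limit_constant qT0 X1 X2 Xq.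
have yh n : affine_point (y n) = Some h by rewrite yX; congr Some; exact: Xh.
have [r r0 E0] := affine_pointE (yh 0%N).
have [s s0 E1] := affine_pointE (yh 1%N).
(* Seen through [Q], the two consecutive convergents are infinity and the finite point [w], which
   cannot be proportional. *)
pose Q := P (N1 + 0)%N; pose w := g (N + (N1 + 0)).+1.
have E : y 1%N = Q *m siegel_vec w.
  rewrite /y /Q /P /w -cfrac_mx_mkseqS.
  by have -> : (N + (N1 + 1) = (N + (N1 + 0)).+1)%N by lia.
have uQ : Q \in unitmx by exact: siegel_unitary_unit (uP _).
have /(congr1 (mulmx (invmx Q))) : Q *m (s *: infty) = Q *m (r *: siegel_vec w).
  rewrite -!scalemxAr -E E1 -[Q *m infty]/(y 0%N) E0 !scalerA.
  by congr (_ *: _); exact: mulrC.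
rewrite !(mulKmx uQ) siegel_vecE !scale_cv3 => /cv3_inj[/eqP + _ _].
by rewrite mulr0 mulr1 eq_sym (negPf r0).
Qed.
End EventuallyPeriodic.

(** * Isometries fixing a null line, and the equivalence *)

Lemma fixed_null_line_triangular (R : realType) (h : R[i] * R[i]) M :
  h \in siegel -> siegel_unitary M ->
  (siegel_vec h)^t* *m siegel_form R *m M *m siegel_vec h = 0 ->
  exists a b c e f i,
    heis_mx (heis_inv h) *m M *m heis_mx h = mx3 a b c 0 e f 0 0 i.
Proof.
move=> hS uM hM; have HV := heis_mxVl hS; have HV' := heis_mxVr hS.
have uH := siegel_unitary_heis_mx hS.
have uT := siegel_unitary_heis_conj hS uM.
have [a [b [c [d [e [f [g [k [i ET]]]]]]]]] := mx3P (heis_mx (heis_inv h) *m M *m heis_mx h).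
rewrite ET in uT *.
(* Once [h] is moved to the origin, the value of the form is [- g]. *)
have g0 : g = 0.
  have : (cv3 1 0 0)^t* *m siegel_form R *m mx3 a b c d e f g k i *m cv3 1 0 0 = 0.
    have HJ : (heis_mx h)^t* *m siegel_form R = siegel_form R *m heis_mx (heis_inv h).
      by rewrite -[in RHS]uH -!mulmxA HV' mulmx1.
    rewrite -ET -hM siegel_vec_origin adjM.
    by rewrite -[_ *m _ *m siegel_form R]mulmxA HJ !mulmxA.
  move=> /matrixP/(_ 0 0); rewrite !mxE !big_ord_recl big_ord0 !mxE /=.
  rewrite !big_ord_recl !big_ord0 !mxE /= !big_ord_recl !big_ord0 !mxE /=.
  rewrite rmorph1 rmorph0 => E; apply/eqP; rewrite -oppr_eq0; apply/eqP.
  by rewrite -[RHS]E; ring.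
have [d0 k0 _ _ _] := siegel_unitary_triangular uT g0.
by exists a, b, c, e, f, i; rewrite d0 k0 g0.
Qed.

Lemma fixed_null_line_expansion (R : realType) (h : R[i] * R[i]) M :
  h \in siegel -> gaussian_unitary M -> not_root_of_unity M ->
  (siegel_vec h)^t* *m siegel_form R *m M *m siegel_vec h = 0 ->
  exists g : nat -> R[i] * R[i], (forall i, g i \in siegel_int) /\
    eventually_periodic g /\ cfrac_expansion g h.
Proof.
move=> hS gM nM hM.
have [a [b [c [e [f [i ET]]]]]] := fixed_null_line_triangular hS gM.2 hM.
have [a1|a1] := real_leP (real1 _) (normr_real a).
  exact: periodic_expansion_triangular hS gM nM ET a1.
(* For [|a| < 1] the inverse of [M] is used: its leading entry is the conjugate of [i], of norm
   above 1. *)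
have HV := heis_mxVl hS; have HV' := heis_mxVr hS.
have uM := siegel_unitary_unit gM.2; have gMV := gaussian_unitaryV gM.
pose T := heis_mx (heis_inv h) *m M *m heis_mx h.
pose T' := heis_mx (heis_inv h) *m invmx M *m heis_mx h.
have TT' : T' *m T = 1%:M.
  rewrite /T /T' !mulmxA -(mulmxA _ _ (heis_mx (heis_inv h))) HV' mulmx1.
  by rewrite -(mulmxA _ (invmx M)) mulVmx // mulmx1.
have uT : siegel_unitary T by exact: siegel_unitary_heis_conj gM.2.
have : T' = siegel_form R *m T^t* *m siegel_form R.
  rewrite -siegel_unitary_invE //.
  by rewrite -[LHS](mulmxK (siegel_unitary_unit uT)) TT' mul1mx.
rewrite /T ET mx3_adj siegel_formE !mul_mx3 !rmorph0.
set X := mx3 _ _ _ _ _ _ _ _ _ => ET'.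
have {}ET' : T' = mx3 i^* (- f^*) c^* 0 e^* (- b^*) 0 0 a^*.
  by rewrite ET' /X; congr mx3; ring.
apply: periodic_expansion_triangular hS gMV _ ET' _.
  move=> n n0 E; apply: (nM n n0).
  by move: E; rewrite -[invmx M]/(M^-1) exprVn => /(congr1 GRing.inv); rewrite invrK invr1.
move: uT; rewrite /T ET => /siegel_unitary_triangular/(_ erefl)[_ _ ai _ _].
have : `|a^* * i| = 1 by rewrite ai normr1.
rewrite normrM !norm_conjC => <-.
by rewrite ler_piMl // ltW.
Qed.

Theorem theorem1p1 (R : realType) (h : R[i] * R[i]) (hS : h \in siegel) :
  (exists g : nat -> R[i] * R[i],
      (forall i, g i \in siegel_int) /\
      eventually_periodic g /\
      cfrac_expansion g h)
  <->
  (exists M : 'M[R[i]]_3,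
      u21_gaussian M /\
      not_root_of_unity M /\
      (siegel_vec h) ^t* *m siegel_form R *m M *m siegel_vec h = 0).
Proof.
split=> [[g [gS [gP gh]]]|[M [/u21_gaussianP gM [nM hM]]]].
  have [M [gM nM [l El]]] := periodic_expansion_matrix gS gP gh.
  exists M; split; [exact/u21_gaussianP | split=> //].
  (* On an eigenvector the form is [l] times its value at the null vector [h]. *)
  by rewrite -mulmxA El -scalemxAr ((siegel_null h).1 hS) scaler0.
exact: fixed_null_line_expansion hM.
Qed.
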